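(* Let $\theta,\omega\in H^\infty$ be inner functions with $\theta(0)=0$ and $\omega(0)=0$. Let $u\in\mathcal K_\omega$ and $T=S_\omega+(\cdot,\overline\chi\omega)u\in\mathcal L(\mathcal K_\omega)$. Let $X\in\mathcal L(\mathcal K_\theta,\mathcal K_\omega)$ satisfy $X^\ast(\overline\chi\omega)=\overline\chi\theta$ and $XU_{(\theta)1}=TX$. Set $g=\dfrac{u-\omega}{1-\theta}$. Then $g\in\mathcal K_\omega$ and $Xf=gf$ for every $f\in\mathcal K_\theta$.
   Context: $m$ is normalized Lebesgue measure on $\mathbb T$; $H^2$ is the Hardy space of the unit disk $\mathbb D$, identified with a subspace of $L^2(m)$ via boundary values, with the $L^2(m)$ inner product. $\chi(z)=z$, $\mathbf 1(z)=1$. For an inner function $\theta$, $\mathcal K_\theta=H^2\ominus\theta H^2$; $S$ is multiplication by $\chi$ on $H^2$ and $S_\theta=P_{\mathcal K_\theta}S|_{\mathcal K_\theta}$. $\overline\chi\theta$ denotes the function $\zeta\mapsto\overline\zeta\theta(\zeta)$ on $\mathbb T$; when $\theta(0)=0$, both $\mathbf 1$ and $\overline\chi\theta$ belong to $\mathcal K_\theta$. $(\cdot,v)u$ denotes the operator $f\mapsto (f,v)u$. For $\theta(0)=0$ and $c\in\mathbb T$, $U_{(\theta)c}=S_\theta+c(\cdot,\overline\chi\theta)\mathbf 1\in\mathcal L(\mathcal K_\theta)$ (a unitary operator). *)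

(* Defs.v *)
From HB Require Import structures.
From mathcomp Require Import all_boot all_order all_algebra.
From mathcomp Require Import all_classical all_reals all_analysis.
From mathcomp Require Import complex.
From Stdlib Require Import ClassicalEpsilon.

Set Implicit Arguments.
Unset Strict Implicit.
Unset Printing Implicit Defensive.

Import Order.TTheory GRing.Theory Num.Theory.
Local Open Scope classical_set_scope.
Local Open Scope ring_scope.

(* The unit circle T is parametrized by t in [0, 2 pi] via t |-> e^{it};
   a function on T is thus a function R -> R[i] (its values on [0,2pi]
   matter, up to Lebesgue-null sets). The normalized Lebesgue measure m on T
   corresponds to (1/(2 pi)) dt on [0, 2 pi]. *)

Section Hardy.
Variable R : realType.
Local Notation C := R[i].
Local Notation leb := (@lebesgue_measure R).

Definition Tdom : set R := `[0%R, 2 * pi]%classic.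

Definition expi (t : R) : C := Complex (cos t) (sin t).

Definition cre (z : C) : R := let: Complex a _ := z in a.
Definition cim (z : C) : R := let: Complex _ b := z in b.
Definition cconj (z : C) : C := Complex (cre z) (- cim z).
Definition sqnorm (z : C) : R := cre z ^+ 2 + cim z ^+ 2.

Definition aeqT (f g : R -> C) : Prop :=
  leb.-negligible (Tdom `&` [set t | f t <> g t]).

Definition L2 (f : R -> C) : Prop :=
  [/\ measurable_fun Tdom (fun t => cre (f t)),
      measurable_fun Tdom (fun t => cim (f t)) &
      leb.-integrable Tdom (fun t => (sqnorm (f t))%:E)].

Definition ip (f g : R -> C) : C :=
  Complex ((2 * pi)^-1 * Rintegral leb Tdom (fun t => cre (f t * cconj (g t))))
          ((2 * pi)^-1 * Rintegral leb Tdom (fun t => cim (f t * cconj (g t)))).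

Definition L2norm (f : R -> C) : R := Num.sqrt (cre (ip f f)).

Definition fourier (f : R -> C) (n : int) : C := ip f (fun t => expi (n%:~R * t)).

(* Hardy space H^2 (boundary values): L^2 functions with vanishing
   negative Fourier coefficients *)
Definition H2 (f : R -> C) : Prop :=
  L2 f /\ forall n : int, (n < 0)%R -> fourier f n = 0.

(* Inner function: (boundary values of) an H^infinity function of modulus
   one a.e. on T. Unimodularity gives boundedness; vanishing negative Fourier
   coefficients give analyticity. *)
Definition inner (th : R -> C) : Prop :=
  [/\ measurable_fun Tdom (fun t => cre (th t)),
      measurable_fun Tdom (fun t => cim (th t)),
      leb.-negligible (Tdom `&` [set t | sqnorm (th t) <> 1]) &
      forall n : int, (n < 0)%R -> fourier th n = 0].

(* value at the origin of an H^2 / H^infinity function = 0-th Fourier coeff. *)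
Definition at0 (f : R -> C) : C := fourier f 0.

Definition Kspace (th : R -> C) (f : R -> C) : Prop :=
  H2 f /\ forall h, H2 h -> ip f (fun t => th t * h t) = 0.

Definition chi : R -> C := expi.
Definition one : R -> C := fun _ => 1.
Definition chibar (th : R -> C) : R -> C := fun t => cconj (chi t) * th t.

Definition is_proj (K : (R -> C) -> Prop) (g h : R -> C) : Prop :=
  K h /\ forall k, K k -> ip (fun t => g t - h t) k = 0.

Definition proj (K : (R -> C) -> Prop) (g : R -> C) : R -> C :=
  epsilon (inhabits (fun _ : R => 0 : C)) (is_proj K g).

Definition Sop (th : R -> C) (f : R -> C) : R -> C :=
  proj (Kspace th) (fun t => chi t * f t).

Definition rank1 (v u : R -> C) (f : R -> C) : R -> C :=
  fun t => ip f v * u t.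

Definition Uop (th : R -> C) (c : C) (f : R -> C) : R -> C :=
  fun t => Sop th f t + c * rank1 (chibar th) one f t.

Definition Top (om u : R -> C) (f : R -> C) : R -> C :=
  fun t => Sop om f t + rank1 (chibar om) u f t.

(* X is a bounded linear operator from K1 to K2 (acting on representatives,
   compatible with a.e. equality) *)
Definition bounded_op (K1 K2 : (R -> C) -> Prop) (X : (R -> C) -> (R -> C)) : Prop :=
  [/\ forall f, K1 f -> K2 (X f),
      forall f g, K1 f -> K1 g -> aeqT f g -> aeqT (X f) (X g),
      forall (a : C) f g, K1 f -> K1 g ->
        aeqT (X (fun t => a * f t + g t)) (fun t => a * X f t + X g t) &
      exists M : R, forall f, K1 f -> L2norm (X f) <= M * L2norm f].

Definition adj_maps (K1 : (R -> C) -> Prop) (X : (R -> C) -> (R -> C))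
  (y z : R -> C) : Prop :=
  forall f, K1 f -> ip (X f) y = ip f z.

End Hardy.

(* Main.v *)
(* [U f = chi f + c (1 - theta)] and [T h = chi h + d (u - omega)] for [f] and
   [h] in the model spaces, with [c = (f, conj chi theta)] and
   [d = (h, conj chi omega)]; for [h = X f] the adjoint hypothesis gives [d = c].
   Hence the defect [D f = (1 - theta) X f - (u - omega) f] satisfies
   [D (U f) = chi (D f)]. As [U] is onto, [D f = chi^n (D f_n)] for every [n],
   with [f_n = U^-n f]. Every [D f_n] is an integrable function without negative
   Fourier coefficients, being built from products of two [H^2] functions, so all
   Fourier coefficients of [D f] vanish and [D f = 0] a.e. Finally [theta <> 1]
   a.e., and [f = 1] gives [g = X 1], which is in the model space of [omega]. *)

(* The defect is built from products of two [L2] functions, so it is only known to be integrable.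
   Orthonormal expansions in [L2] therefore cannot conclude that it vanishes, and uniqueness of
   Fourier coefficients is needed for integrable functions. The absence of negative coefficients in
   a product of two [H2] functions is a second analytic question: it is an orthogonality statement
   for [L2] functions with disjoint spectra, and rests on the density of trigonometric polynomials.
   Both facts have one source: explicit trigonometric polynomials with values in [0, 1] that
   converge a.e. to the indicator of a half-line. A pi-lambda argument carries this to all Borel
   sets, and the uniform bounds let every limit pass under the integral. Operators act on functions
   rather than on classes, and [proj] is picked by choice, so the values of [Sop] and of [X] are
   controlled only up to null sets. Membership in a model space then has to be tracked separately
   from the a.e. formula. *)
Require Import Defs.
From HB Require Import structures.
From mathcomp Require Import all_boot all_order all_algebra.
From mathcomp Require Import all_classical all_reals all_analysis.
From mathcomp Require Import measurable_realfun complex zify ring lra.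
Import Order.TTheory GRing.Theory Num.Theory.
Import numFieldNormedType.Exports.
Local Open Scope ring_scope.

(** * Complex arithmetic through real and imaginary parts *)

Section Complex.
Set Implicit Arguments.
Unset Strict Implicit.
Variable R : realType.
Implicit Types z w : R[i].

Lemma creD z w : cre (z + w) = cre z + cre w. Proof. by case: z; case: w. Qed.
Lemma cimD z w : cim (z + w) = cim z + cim w. Proof. by case: z; case: w. Qed.
Lemma creN z : cre (- z) = - cre z. Proof. by case: z. Qed.
Lemma cimN z : cim (- z) = - cim z. Proof. by case: z. Qed.
Lemma creM z w : cre (z * w) = cre z * cre w - cim z * cim w.
Proof. by case: z; case: w. Qed.
Lemma cimM z w : cim (z * w) = cre z * cim w + cim z * cre w.
Proof. by case: z; case: w. Qed.
Lemma creV z : cre z^-1 = cre z * (sqnorm z)^-1. Proof. by case: z. Qed.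
Lemma cimV z : cim z^-1 = - (cim z * (sqnorm z)^-1). Proof. by case: z. Qed.

Lemma complexE z w : cre z = cre w -> cim z = cim w -> z = w.
Proof. by case: z => a b; case: w => c d /= -> ->. Qed.

Lemma cconjD z w : cconj (z + w) = cconj z + cconj w.
Proof. by apply: complexE; rewrite /= ?creD ?cimD//= opprD. Qed.
Lemma cconjM z w : cconj (z * w) = cconj z * cconj w.
Proof.
apply: complexE; rewrite /= ?creM ?cimM /= ?mulrNN//.
by rewrite opprD mulrN mulNr.
Qed.
Lemma cconjK z : cconj (cconj z) = z.
Proof. by case: z => a b; rewrite /cconj /= opprK. Qed.
Lemma cconj0 : cconj 0 = 0 :> R[i].
Proof. by apply: complexE; rewrite //= oppr0. Qed.
Lemma cconj1 : cconj 1 = 1 :> R[i].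
Proof. by apply: complexE; rewrite //= oppr0. Qed.

Lemma sqnorm_ge0 z : 0 <= sqnorm z.
Proof. by rewrite addr_ge0 ?sqr_ge0. Qed.
Lemma sqnormM z w : sqnorm (z * w) = sqnorm z * sqnorm w.
Proof. by rewrite /sqnorm creM cimM; ring. Qed.
Lemma sqnorm_conj z : sqnorm (cconj z) = sqnorm z.
Proof. by rewrite /sqnorm /= sqrrN. Qed.
Lemma sqnorm0 : sqnorm (0 : R[i]) = 0.
Proof. by rewrite /sqnorm /= expr0n addr0. Qed.
Lemma sqnorm_eq0 z : sqnorm z = 0 -> z = 0.
Proof.
move/eqP; rewrite /sqnorm paddr_eq0 ?sqr_ge0// !sqrf_eq0 => /andP[/eqP a0 /eqP b0].
exact: complexE.
Qed.
Lemma mul_conj z : z * cconj z = Complex (sqnorm z) 0.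
Proof. by apply: complexE; rewrite ?creM ?cimM /= /sqnorm; ring. Qed.
Lemma sqnormD z w : sqnorm (z + w) <= 2 * sqnorm z + 2 * sqnorm w.
Proof.
rewrite /sqnorm creD cimD.
have := sqr_ge0 (cre z - cre w); have := sqr_ge0 (cim z - cim w); lra.
Qed.

Lemma expiD (x y : R) : expi (x + y) = expi x * expi y.
Proof.
by apply: complexE; rewrite ?creM ?cimM /= ?cosD ?sinD//; ring.
Qed.
Lemma expi0 : expi 0 = 1 :> R[i].
Proof. by apply: complexE; rewrite /= ?cos0 ?sin0. Qed.
Lemma cconj_expi (x : R) : cconj (expi x) = expi (- x).
Proof. by rewrite /cconj /expi /= cosN sinN. Qed.
Lemma sqnorm_expi (x : R) : sqnorm (expi x) = 1.
Proof. exact: cos2Dsin2. Qed.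
Lemma expi_conj (x : R) : expi x * cconj (expi x) = 1.
Proof. by rewrite cconj_expi -expiD subrr expi0. Qed.

End Complex.

(** * Integrable and square-integrable functions on [0, 2 pi] *)

Section Integral.
Set Implicit Arguments.
Unset Strict Implicit.
Local Open Scope classical_set_scope.
Variable R : realType.
Local Notation C := R[i].
Local Notation mu := (@lebesgue_measure R).
Local Notation T := (@Tdom R).
Local Notation TT := (T : set (measurableTypeR R)).
Implicit Types f g h : R -> C.

Lemma measurable_Tdom : measurable TT. Proof. exact: measurable_itv. Qed.
Hint Resolve measurable_Tdom : core.

Lemma pi2_gt0 : 0 < 2 * pi :> R. Proof. by rewrite mulr_gt0// pi_gt0. Qed.

Lemma mu_Tdom : mu T = (2 * pi)%:E.
Proof.
by rewrite /Tdom lebesgue_measure_itv/= lte_fin pi2_gt0 -EFinB subr0.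
Qed.

Lemma ae_imp (P Q : R -> Prop) : (forall t, P t -> Q t) ->
  (\forall t \ae mu, P t) -> \forall t \ae mu, Q t.
Proof. by move=> PQ; apply: filterS => //; exact: (ae_filter_ringOfSetsType mu). Qed.

Lemma ae_imp2 (P Q S : R -> Prop) : (forall t, P t -> Q t -> S t) ->
  (\forall t \ae mu, P t) -> (\forall t \ae mu, Q t) -> \forall t \ae mu, S t.
Proof.
by move=> PQ; apply: filterS2 => //; exact: (ae_filter_ringOfSetsType mu).
Qed.

Lemma ae_imp3 (P Q S U : R -> Prop) : (forall t, P t -> Q t -> S t -> U t) ->
  (\forall t \ae mu, P t) -> (\forall t \ae mu, Q t) ->
  (\forall t \ae mu, S t) -> \forall t \ae mu, U t.
Proof.
by move=> PQ; apply: filterS3 => //; exact: (ae_filter_ringOfSetsType mu).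
Qed.

Lemma aeqTP f g : aeqT f g <-> (\forall t \ae mu, T t -> f t = g t).
Proof.
rewrite /aeqT /almost_everywhere; split; apply: negligibleS => t /=.
- by move=> /not_implyP.
- by move=> [Tt fg] /(_ Tt).
Qed.

Definition rint (f : R -> R) : R := Rintegral mu T f.
Definition rintegrable (f : R -> R) := mu.-integrable T (EFin \o f).

Lemma rintegrable_meas (f : R -> R) : rintegrable f -> measurable_fun TT f.
Proof. by move=> /integrableP[/measurable_EFinP]. Qed.

Lemma rintegrableD (f g : R -> R) : rintegrable f -> rintegrable g ->
  rintegrable (fun t => f t + g t).
Proof. by move=> fi gi; have := integrableD measurable_Tdom fi gi. Qed.

Lemma rintegrableZ (c : R) (f : R -> R) : rintegrable f ->
  rintegrable (fun t => c * f t).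
Proof. by move=> fi; have := integrableZl measurable_Tdom c fi. Qed.

Lemma rintegrableB (f g : R -> R) : rintegrable f -> rintegrable g ->
  rintegrable (fun t => f t - g t).
Proof. by move=> fi gi; have := integrableB measurable_Tdom fi gi. Qed.

Lemma rintegrable_cst (c : R) : rintegrable (fun=> c).
Proof.
apply: measurable_bounded_integrable => //.
  by have := mu_Tdom => /= ->; rewrite ltry.
by exists `|c|; split => // x cx t _ /=; exact: ltW.
Qed.

Lemma rintD (f g : R -> R) : rintegrable f -> rintegrable g ->
  rint (fun t => f t + g t) = rint f + rint g.
Proof. by move=> fi gi; rewrite /rint RintegralD. Qed.

Lemma rintB (f g : R -> R) : rintegrable f -> rintegrable g ->
  rint (fun t => f t - g t) = rint f - rint g.
Proof. by move=> fi gi; rewrite /rint RintegralB. Qed.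

Lemma rintZ (c : R) (f : R -> R) : rintegrable f ->
  rint (fun t => c * f t) = c * rint f.
Proof. by move=> fi; rewrite /rint RintegralZl. Qed.

Lemma rint_cst (c : R) : rint (fun=> c) = c * (2 * pi).
Proof. by rewrite /rint Rintegral_cst//; have := mu_Tdom => /= ->. Qed.

Lemma rint_ge0 (f : R -> R) : (forall t, 0 <= f t) -> 0 <= rint f.
Proof. by move=> f0; apply: Rintegral_ge0 => t _. Qed.

Lemma rint_le (f g : R -> R) : rintegrable f -> rintegrable g ->
  (forall t, T t -> f t <= g t) -> rint f <= rint g.
Proof. by move=> fi gi fg; apply: le_Rintegral. Qed.

Lemma rint_ae (f g : R -> R) : measurable_fun TT f -> measurable_fun TT g ->
  (\forall t \ae mu, T t -> f t = g t) -> rint f = rint g.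
Proof.
move=> mf mg fg; congr fine; apply: ae_eq_integral => //.
- exact/measurable_EFinP.
- exact/measurable_EFinP.
- by apply: ae_imp fg => t /= H Tt; rewrite H.
Qed.

Lemma rintegrable_ae_le (f g : R -> R) : measurable_fun TT f ->
  rintegrable g -> (\forall t \ae mu, T t -> `|f t| <= g t) -> rintegrable f.
Proof.
move=> mf gi fg; apply/integrableP; split; first exact/measurable_EFinP.
have /integrableP[mg] := gi; apply: le_lt_trans.
apply: ae_ge0_le_integral => //.
- by apply: measurableT_comp => //; exact/measurable_EFinP.
- by apply: measurableT_comp.
- apply: ae_imp fg => t /= H /H; rewrite lee_fin => /le_trans; apply.
  exact: ler_norm.
Qed.

Lemma rint_eq0_ae (f : R -> R) : rintegrable f -> (forall t, 0 <= f t) ->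
  rint f = 0 -> \forall t \ae mu, T t -> f t = 0.
Proof.
move=> fi f0 if0.
have : (\int[mu]_(x in T) `|(f x)%:E| = 0)%E.
  rewrite -[LHS]fineK; last first.
    by apply: integrable_fin_num => //; exact: integrable_abse.
  congr EFin; rewrite -if0; congr fine; apply: eq_integral => t _ /=.
  by rewrite ger0_norm.
move/ae_eq_integral_abs => /(_ measurable_Tdom) H.
have /integrableP[mf _] := fi.
by have := H mf; apply: ae_imp => t /= K /K [].
Qed.

Definition cmeas f := measurable_fun TT (fun t => cre (f t)) /\
  measurable_fun TT (fun t => cim (f t)).
Definition cintegrable f := rintegrable (fun t => cre (f t)) /\
  rintegrable (fun t => cim (f t)).
Definition cint f : C :=
  Complex (rint (fun t => cre (f t))) (rint (fun t => cim (f t))).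

Lemma cintegrable_meas f : cintegrable f -> cmeas f.
Proof. by move=> [/rintegrable_meas ? /rintegrable_meas]. Qed.

Lemma cmeasD f g : cmeas f -> cmeas g -> cmeas (fun t => f t + g t).
Proof.
move=> [f1 f2] [g1 g2]; split.
- by under eq_fun do rewrite creD; exact: measurable_funD.
- by under eq_fun do rewrite cimD; exact: measurable_funD.
Qed.

Lemma cmeasM f g : cmeas f -> cmeas g -> cmeas (fun t => f t * g t).
Proof.
move=> [f1 f2] [g1 g2]; split.
- under eq_fun do rewrite creM.
  by apply: measurable_funB; apply: measurable_funM.
- under eq_fun do rewrite cimM.
  by apply: measurable_funD; apply: measurable_funM.
Qed.

Lemma cmeas_cst (c : C) : cmeas (fun=> c).
Proof. by split; exact: measurable_cst. Qed.

Lemma cmeasN f : cmeas f -> cmeas (fun t => - f t).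
Proof.
move=> mf; under eq_fun do rewrite -mulN1r.
by apply: cmeasM => //; exact: cmeas_cst.
Qed.

Lemma cmeasB f g : cmeas f -> cmeas g -> cmeas (fun t => f t - g t).
Proof. by move=> mf mg; apply: cmeasD => //; exact: cmeasN. Qed.

Lemma cmeas_conj f : cmeas f -> cmeas (fun t => cconj (f t)).
Proof. by move=> [f1 f2]; split => //=; exact: measurable_funN. Qed.

Lemma meas_sqnorm f : cmeas f -> measurable_fun TT (fun t => sqnorm (f t)).
Proof. by move=> [f1 f2]; apply: measurable_funD; apply: measurable_funX. Qed.

Lemma cmeasV f : cmeas f -> cmeas (fun t => (f t)^-1).
Proof.
move=> mf; have mn := meas_sqnorm mf; case: mf => f1 f2.
have mV : measurable_fun TT (fun t => (sqnorm (f t))^-1).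
  (* On nonnegative reals inversion is the power [-1], also at 0, where both give 0; real powers are
     measurable. *)
  under eq_fun do rewrite -(powR_inv1 (sqnorm_ge0 _)).
  exact: (measurableT_comp (measurable_powR _) mn).
split.
- by under eq_fun do rewrite creV; exact: measurable_funM.
- under eq_fun do rewrite cimV.
  by apply: measurable_funN; exact: measurable_funM.
Qed.

Lemma cmeas_expi (a : R) : cmeas (fun t => expi (a * t)).
Proof.
have ma : measurable_fun TT (fun t : R => a * t).
  exact: mulrl_measurable.
split.
- exact: (measurableT_comp (continuous_measurable_fun (@continuous_cos R)) ma).
- exact: (measurableT_comp (continuous_measurable_fun (@continuous_sin R)) ma).
Qed.

Lemma cintegrableD f g : cintegrable f -> cintegrable g ->
  cintegrable (fun t => f t + g t).
Proof.
move=> [f1 f2] [g1 g2]; split.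
- by under eq_fun do rewrite creD; exact: rintegrableD.
- by under eq_fun do rewrite cimD; exact: rintegrableD.
Qed.

Lemma cintegrableZ (c : C) f : cintegrable f -> cintegrable (fun t => c * f t).
Proof.
move=> [f1 f2]; split.
- by under eq_fun do rewrite creM; apply: rintegrableB; apply: rintegrableZ.
- by under eq_fun do rewrite cimM; apply: rintegrableD; apply: rintegrableZ.
Qed.

Lemma cintegrableB f g : cintegrable f -> cintegrable g ->
  cintegrable (fun t => f t - g t).
Proof.
move=> fi gi; under eq_fun do rewrite -mulN1r.
by apply: cintegrableD => //; exact: cintegrableZ.
Qed.

Lemma cintD f g : cintegrable f -> cintegrable g ->
  cint (fun t => f t + g t) = cint f + cint g.
Proof.
move=> [f1 f2] [g1 g2]; apply: complexE; rewrite /= -rintD//.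
- by congr rint; apply/funext => t; rewrite creD.
- by congr rint; apply/funext => t; rewrite cimD.
Qed.

Lemma cintZ (c : C) f : cintegrable f ->
  cint (fun t => c * f t) = c * cint f.
Proof.
move=> [f1 f2]; apply: complexE; rewrite ?creM ?cimM /= -!rintZ//.
- rewrite -rintB; try exact: rintegrableZ.
  by congr rint; apply/funext => t; rewrite creM.
- rewrite -rintD; try exact: rintegrableZ.
  by congr rint; apply/funext => t; rewrite cimM.
Qed.

Lemma cintB f g : cintegrable f -> cintegrable g ->
  cint (fun t => f t - g t) = cint f - cint g.
Proof.
move=> fi gi; rewrite -[in RHS]mulN1r -cintZ// -cintD//; last exact: cintegrableZ.
by congr cint; apply/funext => t; rewrite mulN1r.
Qed.

Lemma cint_ae f g : cmeas f -> cmeas g -> aeqT f g -> cint f = cint g.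
Proof.
move=> [f1 f2] [g1 g2] /aeqTP fg; congr Complex; apply: rint_ae => //;
  by apply: ae_imp fg => t /= H Tt; rewrite H.
Qed.

Lemma cint_conj f : cintegrable f -> cint (fun t => cconj (f t)) = cconj (cint f).
Proof.
move=> [f1 f2]; apply: complexE => //=.
rewrite -[RHS]mulN1r -rintZ//.
by congr rint; apply/funext => t; rewrite mulN1r.
Qed.

Lemma cintegrable_ae_le f (G : R -> R) : cmeas f -> rintegrable G ->
  (\forall t \ae mu, T t -> `|cre (f t)| <= G t /\ `|cim (f t)| <= G t) ->
  cintegrable f.
Proof.
move=> [f1 f2] Gi H; split; apply: rintegrable_ae_le Gi _ => //;
  by apply: ae_imp H => t /= K /K [].
Qed.

Lemma cre_le1 (z : C) : sqnorm z <= 1 -> `|cre z| <= 1 /\ `|cim z| <= 1.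
Proof.
rewrite /sqnorm => H; split; rewrite -(@ler_pXn2r _ 2)// ?nnegrE// expr1n
  real_normK ?num_real//; apply: le_trans H.
  by rewrite lerDl sqr_ge0.
by rewrite lerDr sqr_ge0.
Qed.

Lemma cintegrableM_bounded f g : cmeas f ->
  (\forall t \ae mu, T t -> sqnorm (f t) <= 1) ->
  cintegrable g -> cintegrable (fun t => f t * g t).
Proof.
move=> mf f1 gi; have [g1 g2] := gi.
apply: (@cintegrable_ae_le _ (fun t => `|cre (g t)| + `|cim (g t)|)).
- by apply: cmeasM => //; exact: cintegrable_meas.
- by apply: rintegrableD; exact: integrable_norm.
- apply: ae_imp f1 => t /= H /H /cre_le1[a1 b1]; rewrite creM cimM; split.
  + apply: le_trans (ler_normB _ _) _; rewrite !normrM.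
    by apply: lerD; rewrite ler_piMl.
  + apply: le_trans (ler_normD _ _) _; rewrite !normrM addrC.
    by apply: lerD; rewrite ler_piMl.
Qed.

Lemma L2_cmeas f : L2 f -> cmeas f. Proof. by case. Qed.
Lemma L2_sqnorm f : L2 f -> rintegrable (fun t => sqnorm (f t)).
Proof. by case. Qed.

Lemma L2P f : cmeas f -> rintegrable (fun t => sqnorm (f t)) -> L2 f.
Proof. by move=> [f1 f2] fi; split. Qed.

Lemma L2D f g : L2 f -> L2 g -> L2 (fun t => f t + g t).
Proof.
move=> fL gL; apply: L2P; first by apply: cmeasD; exact: L2_cmeas.
apply: (@rintegrable_ae_le _ (fun t => 2 * sqnorm (f t) + 2 * sqnorm (g t))).
- by apply: meas_sqnorm; apply: cmeasD; exact: L2_cmeas.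
- by apply: rintegrableD; apply: rintegrableZ; exact: L2_sqnorm.
- by apply: aeW => t _; rewrite ger0_norm ?sqnorm_ge0//; exact: sqnormD.
Qed.

Lemma L2_ae_le f (G : R -> R) : cmeas f -> rintegrable G ->
  (\forall t \ae mu, T t -> sqnorm (f t) <= G t) -> L2 f.
Proof.
move=> mf Gi fG; apply: L2P => //; apply: rintegrable_ae_le Gi _.
  exact: meas_sqnorm.
by apply: ae_imp fG => t /= H /H; rewrite ger0_norm ?sqnorm_ge0.
Qed.

Lemma L2M_bounded f g : cmeas f ->
  (\forall t \ae mu, T t -> sqnorm (f t) <= 1) -> L2 g ->
  L2 (fun t => f t * g t).
Proof.
move=> mf f1 gL; apply: (@L2_ae_le _ (fun t => sqnorm (g t))).
- by apply: cmeasM => //; exact: L2_cmeas.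
- exact: L2_sqnorm.
- by apply: ae_imp f1 => t /= H /H ?; rewrite sqnormM ler_piMl ?sqnorm_ge0.
Qed.

Lemma L2_bounded f : cmeas f -> (\forall t \ae mu, T t -> sqnorm (f t) <= 1) -> L2 f.
Proof. by move=> mf f1; apply: L2_ae_le f1 => //; exact: rintegrable_cst. Qed.

Lemma L2Z (c : C) f : L2 f -> L2 (fun t => c * f t).
Proof.
move=> fL; apply: (@L2_ae_le _ (fun t => sqnorm c * sqnorm (f t))).
- by apply: cmeasM; [exact: cmeas_cst|exact: L2_cmeas].
- by apply: rintegrableZ; exact: L2_sqnorm.
- by apply: aeW => t _; rewrite sqnormM.
Qed.

Lemma L2B f g : L2 f -> L2 g -> L2 (fun t => f t - g t).
Proof.
move=> fL gL; under eq_fun do rewrite -mulN1r.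
by apply: L2D => //; exact: L2Z.
Qed.

Lemma L2_conj f : L2 f -> L2 (fun t => cconj (f t)).
Proof.
move=> fL; apply: (@L2_ae_le _ (fun t => sqnorm (f t))).
- by apply: cmeas_conj; exact: L2_cmeas.
- exact: L2_sqnorm.
- by apply: aeW => t _; rewrite sqnorm_conj.
Qed.

Lemma L2_cst (c : C) : L2 (fun=> c).
Proof.
apply: (@L2_ae_le _ (fun=> sqnorm c)); [exact: cmeas_cst|exact: rintegrable_cst|].
exact: aeW.
Qed.

(** Measurability is meant for Borel sets, so it does not pass along a.e. equality and has to be
    supplied for [g]. *)
Lemma L2_ae f g : cmeas g -> aeqT f g -> L2 f -> L2 g.
Proof.
move=> mg /aeqTP fg fL; apply: (L2_ae_le mg (L2_sqnorm fL)).
by apply: ae_imp fg => t /= H /H ->.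
Qed.

Lemma L2_cintegrableM f g : L2 f -> L2 g -> cintegrable (fun t => f t * g t).
Proof.
move=> fL gL.
apply: (@cintegrable_ae_le _ (fun t => sqnorm (f t) + sqnorm (g t))).
- by apply: cmeasM; exact: L2_cmeas.
- by apply: rintegrableD; exact: L2_sqnorm.
- apply: aeW => t _; rewrite creM cimM /sqnorm.
  move: (cre _) (cim _) (cre _) (cim _) => a b c d.
  (* Each of the four real products is at most half the sum of the two squares; this replaces the
     Hoelder inequality. *)
  have := sqr_ge0 (a - c); have := sqr_ge0 (a + c).
  have := sqr_ge0 (b - d); have := sqr_ge0 (b + d).
  have := sqr_ge0 (a - d); have := sqr_ge0 (a + d).
  have := sqr_ge0 (b - c); have := sqr_ge0 (b + c).
  by rewrite !ler_norml; split; apply/andP; split; lra.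
Qed.

Lemma L2_cintegrable f : L2 f -> cintegrable f.
Proof.
move=> fL; have := L2_cintegrableM fL (L2_cst 1).
by under eq_fun do rewrite mulr1.
Qed.

Lemma ipE f g : ip f g = Complex (2 * pi)^-1 0 * cint (fun t => f t * cconj (g t)).
Proof. by rewrite /ip; apply: complexE; rewrite ?creM ?cimM /= mul0r ?subr0 ?addr0. Qed.

Lemma ip_eq0 f g : ip f g = 0 <-> cint (fun t => f t * cconj (g t)) = 0.
Proof.
rewrite ipE; split=> [/eqP|->]; last by rewrite mulr0.
rewrite mulf_eq0 => /orP[|/eqP//]; rewrite eq_complex /= invr_eq0.
by rewrite (gt_eqF pi2_gt0).
Qed.

(** Fixes the sign convention of everything below: coefficients are tested by plain multiplication
    with [expi], at the opposite frequency. The absence of negative coefficients thus reads as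
    vanishing against [expi (n * t)] for positive [n]. *)
Lemma fourier_eq0 f n :
  fourier f n = 0 <-> cint (fun t => f t * expi ((- n)%:~R * t)) = 0.
Proof.
rewrite /fourier ip_eq0.
by under [X in cint X]eq_fun do rewrite cconj_expi -mulNr -mulrNz.
Qed.

End Integral.
#[global] Hint Resolve measurable_Tdom : core.

(** * Trigonometric polynomials approximating indicators of half-lines *)

Section TrigPoly.
Set Implicit Arguments.
Unset Strict Implicit.
Local Open Scope classical_set_scope.
Local Open Scope complex_scope.
Variable R : realType.
Local Notation C := R[i].
Local Notation mu := (@lebesgue_measure R).
Local Notation T := (@Tdom R).
Local Notation TT := (T : set (measurableTypeR R)).
Implicit Types f g h : R -> C.

(** Coefficient and frequency pairs, with repeated frequencies allowed: sums become concatenations,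
    and a polynomial can be split by filtering its list. *)
Definition tpoly (s : seq (C * int)) (t : R) : C :=
  \sum_(x <- s) x.1 * expi (x.2%:~R * t).

Definition is_tpoly f := exists s, f = tpoly s.

Lemma tpoly_nil t : tpoly [::] t = 0. Proof. by rewrite /tpoly big_nil. Qed.

Lemma tpoly_cons x s t :
  tpoly (x :: s) t = x.1 * expi (x.2%:~R * t) + tpoly s t.
Proof. by rewrite /tpoly big_cons. Qed.

Lemma is_tpolyD f g : is_tpoly f -> is_tpoly g -> is_tpoly (fun t => f t + g t).
Proof.
move=> [s ->] [s' ->]; exists (s ++ s').
by apply/funext => t; rewrite /tpoly big_cat.
Qed.

Lemma is_tpoly_expi (c : C) (n : int) : is_tpoly (fun t => c * expi (n%:~R * t)).
Proof.
by exists [:: (c, n)]; apply/funext => t; rewrite tpoly_cons tpoly_nil addr0.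
Qed.

Lemma is_tpoly_cst (c : C) : is_tpoly (fun=> c).
Proof.
have := is_tpoly_expi c 0; congr is_tpoly; apply/funext => t.
by rewrite mul0r expi0 mulr1.
Qed.

Lemma is_tpolyM f g : is_tpoly f -> is_tpoly g -> is_tpoly (fun t => f t * g t).
Proof.
move=> [s ->] [s' ->]; elim: s => [|[c n] s IH].
  by under eq_fun do rewrite tpoly_nil mul0r; exact: is_tpoly_cst.
under eq_fun do rewrite tpoly_cons mulrDl; apply: is_tpolyD => //= {IH}.
exists [seq (c * x.1, n + x.2) | x <- s']; apply/funext => t.
rewrite /tpoly big_map mulr_sumr; apply: eq_bigr => x _ /=.
by rewrite intrD mulrDl expiD; ring.
Qed.

Lemma is_tpolyX f n : is_tpoly f -> is_tpoly (fun t => f t ^+ n).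
Proof.
move=> fT; elim: n => [|n IH].
  by under eq_fun do rewrite expr0; exact: is_tpoly_cst.
by under eq_fun do rewrite exprS; exact: is_tpolyM.
Qed.

Lemma is_tpolyB f g : is_tpoly f -> is_tpoly g -> is_tpoly (fun t => f t - g t).
Proof.
move=> fT gT; under eq_fun do rewrite -[- g _]mulN1r.
by apply: is_tpolyD => //; apply: is_tpolyM => //; exact: is_tpoly_cst.
Qed.

Lemma L2_expi (a : R) : L2 (fun t => expi (a * t)).
Proof.
apply: L2_bounded; first exact: cmeas_expi.
by apply: aeW => t _; rewrite sqnorm_expi.
Qed.

Lemma L2_tpoly s : L2 (tpoly s).
Proof.
elim: s => [|x s IH].
  by rewrite (funext tpoly_nil); exact: L2_cst.
rewrite (funext (tpoly_cons x s)).
by apply: L2D => //; apply: L2Z; exact: L2_expi.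
Qed.

Lemma cintegrableM_expi f (a : R) : cintegrable f ->
  cintegrable (fun t => f t * expi (a * t)).
Proof.
move=> fi; under eq_fun do rewrite mulrC; apply: cintegrableM_bounded => //.
  exact: cmeas_expi.
by apply: aeW => t _; rewrite sqnorm_expi.
Qed.

Lemma cint_tpoly_eq0 f s : cintegrable f ->
  (forall n : int, cint (fun t => f t * expi (n%:~R * t)) = 0) ->
  cintegrable (fun t => f t * tpoly s t) /\ cint (fun t => f t * tpoly s t) = 0.
Proof.
move=> fi f0; elim: s => [|[c n] s [IHi IH]].
  have -> : (fun t => f t * tpoly [::] t) = fun=> 0.
    by apply/funext => t; rewrite tpoly_nil mulr0.
  split; first exact: L2_cintegrable (L2_cst 0).
  by apply: complexE; rewrite /= rint_cst mul0r.
have -> : (fun t => f t * tpoly ((c, n) :: s) t) =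
    (fun t => c * (f t * expi (n%:~R * t)) + f t * tpoly s t).
  by apply/funext => t; rewrite tpoly_cons /=; ring.
have ei := cintegrableM_expi n%:~R fi.
split; first by apply: cintegrableD => //; exact: cintegrableZ.
by rewrite cintD ?cintZ ?f0 ?IH ?mulr0 ?addr0//; exact: cintegrableZ.
Qed.

(** The switching polynomials of an elementary proof of the Stone-Weierstrass theorem. With
    [a = y ^+ n] and [m = 2 ^ n] one has [m * a = (2 * y) ^+ n], which tends to 0 or to infinity
    according to the side of 1/2 on which [y] lies. Being polynomial in [y], they preserve
    trigonometric polynomials. *)
Definition sharpen (n : nat) (y : R) : R := (1 - y ^+ n) ^+ (2 ^ n)%N.

Lemma bernoulli_sub (a : R) m : 0 <= a <= 1 -> 1 - m%:R * a <= (1 - a) ^+ m.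
Proof.
move=> /andP[a0 a1]; elim: m => [|m IH]; first by rewrite expr0 mul0r subr0.
rewrite exprS; apply: (@le_trans _ _ ((1 - a) * (1 - m%:R * a))); last first.
  by rewrite ler_wpM2l// subr_ge0.
have : 0 <= m%:R * (a * a) by rewrite !mulr_ge0.
by rewrite -natr1; lra.
Qed.

(** The induction step is [(1 - a) * (1 + (m + 1) * a) = 1 + m * a - (m + 1) * a ^+ 2]. It serves as
    the bound [1 / (1 + m * a)] on the power, which decays when [m * a] grows. *)
Lemma bernoulli_mul (a : R) m : 0 <= a <= 1 -> (1 - a) ^+ m * (1 + m%:R * a) <= 1.
Proof.
move=> /andP[a0 a1]; elim: m => [|m IH]; first by rewrite expr0 mul0r addr0 mulr1.
apply: le_trans IH; rewrite exprSr -mulrA ler_wpM2l ?exprn_ge0 ?subr_ge0//.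
have : 0 <= m%:R * (a * a) by rewrite !mulr_ge0.
by have := mulr_ge0 a0 a0; rewrite -natr1; lra.
Qed.

Lemma sharpen_itv n (y : R) : 0 <= y <= 1 -> 0 <= sharpen n y <= 1.
Proof.
move=> /andP[y0 y1]; have yn : 0 <= 1 - y ^+ n <= 1.
  by rewrite subr_ge0 exprn_ile1//= lerBlDr lerDl exprn_ge0.
by have /andP[? ?] := yn; rewrite /sharpen exprn_ge0//= exprn_ile1.
Qed.

Lemma sharpen_cvg1 (y : R) : 0 <= y < 2^-1 -> sharpen n y @[n --> \oo] --> (1 : R).
Proof.
move=> /andP[y0 y2]; have y1 : y <= 1 by lra.
have H n : 1 - (2 * y) ^+ n <= sharpen n y <= 1.
  have /andP[_ ->] := @sharpen_itv n y (introT andP (conj y0 y1)).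
  rewrite andbT exprMn -natrX; apply: bernoulli_sub.
  by rewrite exprn_ge0//= exprn_ile1.
apply: (@squeeze_cvgr _ _ _ _ (fun n => 1 - (2 * y) ^+ n) (fun=> 1)).
- exact: nearW.
- rewrite -[X in _ --> X]subr0; apply: cvgB; first exact: cvg_cst.
  by apply: cvg_expr; rewrite ger0_norm; lra.
- exact: cvg_cst.
Qed.

Lemma sharpen_cvg0 (y : R) : 2^-1 < y <= 1 -> sharpen n y @[n --> \oo] --> (0 : R).
Proof.
move=> /andP[y2 y1]; have y0 : 0 <= y by lra.
have z0 : 0 < 2 * y by lra.
have H n : 0 <= sharpen n y <= (2 * y)^-1 ^+ n.
  have /andP[-> _] /= := @sharpen_itv n y (introT andP (conj y0 y1)).
  rewrite exprVn -[leRHS]mul1r ler_pdivlMr ?exprn_gt0//.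
  have yn : 0 <= y ^+ n <= 1 by rewrite exprn_ge0//= exprn_ile1.
  apply: le_trans (bernoulli_mul (2 ^ n) yn).
  apply: ler_wpM2l; last by rewrite exprMn -natrX; lra.
  by apply: exprn_ge0; rewrite subr_ge0; case/andP: yn.
apply: (@squeeze_cvgr _ _ _ _ (fun=> 0) (fun n => (2 * y)^-1 ^+ n)).
- exact: nearW.
- exact: cvg_cst.
- apply: cvg_expr; rewrite ger0_norm ?invr_ge0; last exact: ltW.
  by rewrite invf_lt1//; lra.
Qed.

(* [bump x < 1/2] exactly on [(x, 2 pi)], by
   [cos (x/2) - cos (t - x/2) = 2 sin (t/2) sin ((t-x)/2)]. *)
Definition bump (x t : R) : R := 2^-1 - 4^-1 * (cos (x / 2) - cos (t - x / 2)).

Lemma bump_itv x t : 0 <= bump x t <= 1.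
Proof.
rewrite /bump; have := cos_geN1 (x / 2); have := cos_le1 (x / 2).
have := cos_geN1 (t - x / 2); have := cos_le1 (t - x / 2).
by move=> *; apply/andP; split; lra.
Qed.

(** This form shows the sign of [bump - 1/2]; the defining form, in which [t] enters with frequency
    one, shows that it is a trigonometric polynomial, although each sine has half-integer
    frequency. *)
Lemma bumpE x t : bump x t = 2^-1 - 2^-1 * (sin (t / 2) * sin ((t - x) / 2)).
Proof.
rewrite /bump; have -> : x / 2 = t / 2 - (t - x) / 2 by field.
have -> : t - (t / 2 - (t - x) / 2) = t / 2 + (t - x) / 2 by field.
by rewrite cosB cosD; field.
Qed.

(** The excluded points 0, [2 * pi] and [x] are those at which a sine factor vanishes and [bump]
    equals 1/2. Elsewhere both half-angles lie in []-pi, pi[] and their signs decide the limit. *)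
Lemma sharpen_bump_cvg x t : 0 <= x <= 2 * pi -> 0 < t < 2 * pi -> t != x ->
  sharpen n (bump x t) @[n --> \oo] --> ((x < t)%R%:R : R).
Proof.
move=> /andP[x0 x2] /andP[t0 t2]; have /andP[b0 b1] := bump_itv x t.
have st : 0 < sin (t / 2) by apply: sin_gt0_pi; apply/andP; split; lra.
rewrite neq_lt => /orP[tx|xt].
- rewrite ltNge (ltW tx) /=; apply: sharpen_cvg0; rewrite b1 andbT bumpE.
  have : 0 < sin (t / 2) * sin ((x - t) / 2).
    by rewrite mulr_gt0//; apply: sin_gt0_pi; apply/andP; split; lra.
  have -> : (t - x) / 2 = - ((x - t) / 2) by field.
  by rewrite sinN mulrN; lra.
- rewrite xt; apply: sharpen_cvg1; rewrite b0 /= bumpE.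
  have : 0 < sin (t / 2) * sin ((t - x) / 2).
    by rewrite mulr_gt0//; apply: sin_gt0_pi; apply/andP; split; lra.
  by lra.
Qed.

Lemma is_tpoly_bump x : is_tpoly (fun t => (bump x t)%:C).
Proof.
pose a := x / 2.
(* The term [cos (t - a) / 4] contributes the frequencies 1 and -1 with weight 1/8 each. *)
have e t : (bump x t)%:C = ((2^-1 - 4^-1 * cos a)%:C
    + (8^-1)%:C * expi (- a) * expi (1%:~R * t))
    + (8^-1)%:C * expi a * expi ((-1)%:~R * t).
  rewrite /bump -/a mulNr !mul1r cosB -cconj_expi.
  by apply: complexE; rewrite !(creD, cimD, creM, cimM) /= ?cosN ?sinN; field.
under eq_fun do rewrite e.
apply: is_tpolyD; last exact: is_tpoly_expi.
by apply: is_tpolyD; [exact: is_tpoly_cst|exact: is_tpoly_expi].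
Qed.

Lemma is_tpoly_sharpen_bump n x : is_tpoly (fun t => (sharpen n (bump x t))%:C).
Proof.
under eq_fun do rewrite /sharpen rmorphXn rmorphB rmorphXn rmorph1.
apply: is_tpolyX; apply: is_tpolyB; first exact: is_tpoly_cst.
by apply: is_tpolyX; exact: is_tpoly_bump.
Qed.

Lemma meas_sharpen_bump n x : measurable_fun TT (fun t => sharpen n (bump x t)).
Proof.
have [s e] := is_tpoly_sharpen_bump n x.
have [m _] := L2_cmeas (L2_tpoly s).
by have := m; under eq_fun do rewrite -e.
Qed.

Lemma ae_neq (a : R) : \forall t \ae mu, t != a.
Proof.
exists [set a]; split; [exact: measurable_set1|exact: lebesgue_measure_set1|].
by move=> t /=; move/negP; rewrite negbK => /eqP.
Qed.

Lemma sharpen_bump_ae (x : R) : exists y, \forall t \ae mu, T t ->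
  sharpen n (bump y t) @[n --> \oo] --> (\1_(`]x, +oo[) t : R).
Proof.
(* Clamping [x] to [0, 2 pi] changes the trace of the half-line on [T] by a null set at most. *)
exists (Num.min (Num.max x 0) (2 * pi)); set y := Num.min _ _.
have p0 := @pi2_gt0 R.
have y02 : 0 <= y <= 2 * pi.
  by rewrite /y le_min ge_min lexx orbT le_max lexx orbT (ltW p0).
have [a b] := (ae_neq y, ae_imp2 (fun t a b => conj a b) (ae_neq 0) (ae_neq (2 * pi))).
apply: ae_imp2 a b => t ty [t0 t2].
rewrite /Tdom /= in_itv /= => /andP[t0' t2'].
have t0'' : 0 < t by rewrite lt_neqAle eq_sym t0.
have t2'' : t < 2 * pi by rewrite lt_neqAle t2.
have -> : \1_(`]x, +oo[) t = (y < t)%R%:R :> R.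
  rewrite indicE mem_setE in_itv /= andbT /y gt_min gt_max t0'' andbT.
  by rewrite [2 * pi < t]ltNge t2' orbF.
by apply: sharpen_bump_cvg => //; rewrite t0''.
Qed.

End TrigPoly.

(** * Integrable functions are determined by their Fourier coefficients *)

Section Density.
Set Implicit Arguments.
Unset Strict Implicit.
Local Open Scope classical_set_scope.
Local Open Scope complex_scope.
Variable R : realType.
Local Notation C := R[i].
Local Notation mu := (@lebesgue_measure R).
Local Notation T := (@Tdom R).
Local Notation TT := (T : set (measurableTypeR R)).

Lemma rint_dominated (h_ : nat -> R -> R) (h G : R -> R) :
  (forall n, measurable_fun TT (h_ n)) -> measurable_fun TT h ->
  (\forall t \ae mu, T t -> h_ n t @[n --> \oo] --> h t) ->
  rintegrable G -> (forall n t, T t -> `|h_ n t| <= G t) ->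
  rintegrable h /\ rint (h_ n) @[n --> \oo] --> rint h.
Proof.
move=> mh_ mh cvh Gi hG.
have [] := @dominated_convergence _ _ _ mu TT (@measurable_Tdom R)
  (fun n => EFin \o h_ n) (EFin \o h) (EFin \o G).
- by move=> n; exact/measurable_EFinP.
- exact/measurable_EFinP.
- apply: ae_imp cvh => t H Tt; apply: cvg_EFin; last exact: H.
  exact: nearW.
- exact: Gi.
- by apply: aeW => t n Tt; rewrite lee_fin hG.
move=> hi _ cv; split=> //; apply: fine_cvg.
rewrite fineK //; exact: integrable_fin_num.
Qed.

(** A pi-lambda argument phrased for functions: the open right half-lines are stable under
    intersection and generate the Borel sets, complements are differences with 1, and disjoint
    unions are bounded limits of sums. The two uses are the uniqueness theorem and the density in
    [L2]. *)
Lemma indic_induction (P : (R -> R) -> Prop) :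
  P (fun=> 1) -> (forall f g, P f -> P g -> P (fun t => f t - g t)) ->
  (forall n x, P (fun t => sharpen n (bump x t))) ->
  (forall (f_ : nat -> R -> R) (f : R -> R),
     (forall n, P (f_ n)) -> (forall n, measurable_fun TT (f_ n)) ->
     measurable_fun TT f -> (forall n t, 0 <= f_ n t <= 1) ->
     (forall t, 0 <= f t <= 1) ->
     (\forall t \ae mu, T t -> f_ n t @[n --> \oo] --> f t) -> P f) ->
  forall S : set (measurableTypeR R), measurable S -> P (\1_S).
Proof.
move=> P1 PB Pb Plim S mS.
have ind01 (A : set R) t : 0 <= (\1_A t : R) <= 1.
  by rewrite indicE; case: (_ \in _); rewrite /= ?lexx ?ler01.
have mind (A : set (measurableTypeR R)) : measurable A ->
    measurable_fun TT (\1_A : R -> R) by exact: measurable_indic.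
have P0 : P (fun=> 0) by have := PB _ _ P1 P1; under eq_fun do rewrite subrr.
have PD f g : P f -> P g -> P (fun t => f t + g t).
  move=> Pf Pg; have := PB _ _ Pf (PB _ _ P0 Pg).
  by under eq_fun do rewrite sub0r opprK.
refine (@dynkin_induction _ (measurableTypeR R) (@RGenOInfty.G R)
  (fun S => P (\1_S)) _ _ _ _ _ _ S _).
- exact: RGenOInfty.measurableE.
- move=> _ _ [x ->] [y ->]; exists (Num.max x y).
  by apply/seteqP; split=> t /=; rewrite !in_itv /= !andbT gt_max => /andP.
- by rewrite indicT.
- move=> _ [x ->]; have [y cvy] := sharpen_bump_ae x.
  apply: (Plim (fun n t => sharpen n (bump y t))) => //.
    by move=> n; exact: meas_sharpen_bump.
  by move=> n t; apply: sharpen_itv; exact: bump_itv.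
- move=> A mA PA; have := PB _ _ P1 PA; congr P; apply/funext => t.
  by rewrite !indicE in_setC; case: (_ \in _); rewrite /= ?subrr ?subr0.
- move=> F mF tF PF.
  have mU n : measurable (\big[setU/set0]_(k < n) F k : set (measurableTypeR R)).
    by apply: bigsetU_measurable => k _; exact: mF.
  apply: (Plim (fun n => \1_(\big[setU/set0]_(k < n) F k))) => //.
  + elim=> [|n IH]; first by rewrite big_ord0 indic0.
    have := PD _ _ IH (PF n); congr P; apply/funext => t.
    rewrite big_ord_recr /= !indicE in_setU.
    (* At a point of [F n], disjointness keeps all earlier sets away, so the indicators add up. *)
    have [tn|] := boolP (t \in F n); last by rewrite orbF addr0.
    rewrite orbT; case: (boolP (t \in _)) => [|_]; last by rewrite add0r.
    rewrite inE -bigcup_mkord => -[k /= kn Fk].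
    have kE : k = n by apply: tF => //; exists t; split => //; exact: set_mem.
    by move: kn; rewrite kE ltnn.
  + by apply: measurable_indic; exact: bigcupT_measurable.
  + apply: aeW => t _; apply: cvg_near_cst.
    (* At every point the partial indicators are eventually constant: from index [k + 1] on inside
       [F k], always outside the union. *)
    have [[k _ Fk]|nF] := pselect ((\bigcup_k F k) t).
    * exists k.+1 => // n /= kn; rewrite !indicE !mem_set//; first by exists k.
      by rewrite -bigcup_mkord; exists k.
    * apply: nearW => n; rewrite !indicE !memNset// -bigcup_mkord.
      by move=> [k _ Fk]; apply: nF; exists k.
- have := mS; rewrite RGenOInfty.measurableE; exact.
Qed.

(** Tested on the set where [h] is positive, the hypothesis gives a nonnegative function with zero
    integral. The opposite inequality will come from [- h]. *)
Lemma rint_indic_ge0_ae (h : R -> R) : rintegrable h ->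
  (forall S : set (measurableTypeR R), measurable S ->
     rint (fun t => h t * \1_S t) = 0) ->
  \forall t \ae mu, T t -> h t <= 0.
Proof.
move=> hi h0; have mh := rintegrable_meas hi.
pose A : set (measurableTypeR R) := T `&` h @^-1` `]0, +oo[.
have mA : measurable A by apply: mh => //; exact: measurable_itv.
have hA t : t \in A -> 0 < h t.
  by rewrite inE => -[_] /=; rewrite in_itv /= andbT.
have iA : rintegrable (fun t => h t * \1_A t).
  apply: (@rintegrable_ae_le _ _ (fun t => `|h t|)).
  - by apply: measurable_funM => //; exact: measurable_indic.
  - exact: integrable_norm.
  - apply: aeW => t _; rewrite indicE; case: (_ \in _); first by rewrite mulr1.
    by rewrite mulr0 normr0.
apply: ae_imp (rint_eq0_ae iA _ (h0 _ mA)).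
- move=> t H /[dup] Tt /H /eqP; rewrite leNgt mulf_eq0 => H'.
  apply/negP => ht; move: H'; rewrite (gt_eqF ht) /= indicE mem_set ?oner_eq0//.
  by split => //=; rewrite in_itv /= ht.
- move=> t; rewrite indicE; case: (boolP (t \in A)) => [/hA/ltW|_].
    by rewrite mulr1.
  by rewrite mulr0.
Qed.

(** Multipliers with values in [0, 1] keep the integrand below [|h|], so dominated convergence
    carries the vanishing from sharpened bumps to all Borel indicators. *)
Lemma rint_sharpen_eq0_ae (h : R -> R) : rintegrable h -> rint h = 0 ->
  (forall n x, rint (fun t => h t * sharpen n (bump x t)) = 0) ->
  \forall t \ae mu, T t -> h t = 0.
Proof.
move=> hi h0 hb; have mh := rintegrable_meas hi.
have dom (f : R -> R) : (forall t, 0 <= f t <= 1) ->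
    forall t, `|h t * f t| <= `|h t|.
  move=> f01 t; have /andP[f0 f1] := f01 t.
  by rewrite normrM (ger0_norm f0) ler_piMr.
have H (S : set (measurableTypeR R)) : measurable S ->
    rintegrable (fun t => h t * \1_S t) /\ rint (fun t => h t * \1_S t) = 0.
  apply: (indic_induction (P := fun f => rintegrable (fun t => h t * f t)
    /\ rint (fun t => h t * f t) = 0)).
  - by under eq_fun do rewrite mulr1.
  - move=> f g [fi f0] [gi g0].
    under eq_fun do rewrite mulrBr.
    by rewrite rintB// f0 g0 subrr; split=> //; exact: rintegrableB.
  - move=> n x; split=> //.
    apply: (@rintegrable_ae_le _ _ (fun t => `|h t|)).
    + by apply: measurable_funM => //; exact: meas_sharpen_bump.
    + exact: integrable_norm.
    + apply: aeW => t _; apply: (dom (fun t => sharpen n (bump x t))).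
      by move=> ?; apply: sharpen_itv; exact: bump_itv.
  - move=> f_ f Pf_ mf_ mf f_01 f01 cvf.
    have [||||| hfi cv] := @rint_dominated (fun n t => h t * f_ n t)
      (fun t => h t * f t) (fun t => `|h t|).
    + by move=> n; apply: measurable_funM.
    + by apply: measurable_funM.
    + by apply: ae_imp cvf => t K /K; apply: cvgM; exact: cvg_cst.
    + exact: integrable_norm.
    + by move=> n t _; exact: (dom (f_ n)).
    split=> //; apply: cvg_unique cv _; first exact: norm_hausdorff.
    have -> : (fun n => rint (fun t => h t * f_ n t)) = fun=> 0.
      by apply/funext => n; have [] := Pf_ n.
    exact: cvg_cst.
have le := rint_indic_ge0_ae hi (fun S mS => (H S mS).2).
have hNi : rintegrable (fun t => - h t).
  by have := rintegrableZ (-1) hi; under eq_fun do rewrite mulN1r.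
have ge : \forall t \ae mu, T t -> - h t <= 0.
  apply: rint_indic_ge0_ae => // S mS.
  under [X in rint X]eq_fun do rewrite mulNr -mulN1r.
  by have [Si S0] := H S mS; rewrite rintZ// S0 mulr0.
apply: ae_imp2 le ge => t a b Tt; apply/eqP.
by rewrite eq_le a//= -oppr_le0 b.
Qed.

(** The sharpened bumps are real-valued trigonometric polynomials, so integrals against them
    separate into the real and imaginary parts of [f], to which the real statement applies. *)
Lemma cint_expi_eq0_ae (f : R -> C) : cintegrable f ->
  (forall n : int, cint (fun t => f t * expi (n%:~R * t)) = 0) ->
  aeqT f (fun=> 0).
Proof.
move=> fi f0.
have H n x : cint (fun t => f t * (sharpen n (bump x t))%:C) = 0.
  have [s e] := is_tpoly_sharpen_bump n x.
  have -> : (fun t => f t * (sharpen n (bump x t))%:C) = (fun t => f t * tpoly s t).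
    by apply/funext => t; rewrite -e.
  by have [] := cint_tpoly_eq0 s fi f0.
have i0 : cint f = 0.
  rewrite -[RHS](f0 0); congr cint; apply/funext => t.
  by rewrite mul0r expi0 mulr1.
have [f1 f2] := fi.
apply/aeqTP; apply: ae_imp2 (rint_sharpen_eq0_ae f1 _ _)
  (rint_sharpen_eq0_ae f2 _ _).
- by move=> t a b Tt; apply: complexE; rewrite ?a ?b.
- exact: (congr1 (@cre R) i0).
- move=> n x; rewrite -[RHS](congr1 (@cre R) (H n x)) /=.
  by congr rint; apply/funext => t; rewrite creM /= mulr0 subr0.
- exact: (congr1 (@cim R) i0).
- move=> n x; rewrite -[RHS](congr1 (@cim R) (H n x)) /=.
  by congr rint; apply/funext => t; rewrite cimM /= mulr0 add0r.
Qed.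

End Density.

(** * Density of trigonometric polynomials in [L2] *)

Section L2Density.
Set Implicit Arguments.
Unset Strict Implicit.
Local Open Scope classical_set_scope.
Local Open Scope complex_scope.
Variable R : realType.
Local Notation C := R[i].
Local Notation mu := (@lebesgue_measure R).
Local Notation T := (@Tdom R).
Local Notation TT := (T : set (measurableTypeR R)).
Implicit Types f g h : R -> C.

(** The squared distance, without root or normalization: [sqnormD] then plays the triangle
    inequality at the price of a factor 2, whence the tolerances [e / 4] below. *)
Definition sqdist f g : R := rint (fun t => sqnorm (f t - g t)).

Definition L2approx f := L2 f /\
  forall e : R, 0 < e -> exists s, sqdist f (tpoly s) <= e.

Lemma L2approxD f g : L2approx f -> L2approx g ->
  L2approx (fun t => f t + g t).
Proof.
move=> [fL fa] [gL ga]; split; first exact: L2D.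
move=> e e0; have e4 : 0 < e / 4 by rewrite divr_gt0.
have [s fs] := fa _ e4; have [s' gs] := ga _ e4.
exists (s ++ s'); have fsL := L2B fL (L2_tpoly s); have gsL := L2B gL (L2_tpoly s').
apply: (@le_trans _ _ (2 * sqdist f (tpoly s) + 2 * sqdist g (tpoly s'))); last lra.
rewrite /sqdist -!rintZ -?rintD; try exact: rintegrableZ; try exact: L2_sqnorm.
- apply: rint_le.
  + by apply: L2_sqnorm; apply: L2B; [exact: L2D|exact: L2_tpoly].
  + by apply: rintegrableD; apply: rintegrableZ; exact: L2_sqnorm.
  + move=> t _; apply: le_trans (sqnormD _ _).
    have -> : tpoly (s ++ s') t = tpoly s t + tpoly s' t by rewrite /tpoly big_cat.
    by rewrite addrACA opprD.
- by apply: rintegrableZ; exact: L2_sqnorm.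
- by apply: rintegrableZ; exact: L2_sqnorm.
Qed.

Lemma L2approxZ (c : C) f : L2approx f -> L2approx (fun t => c * f t).
Proof.
move=> [fL fa]; split; first exact: L2Z.
move=> e e0; have n0 := sqnorm_ge0 c.
(* The added 1 keeps the divisor positive when [c] is 0. *)
have n1 : 0 < sqnorm c + 1 by lra.
have [s fs] := fa _ (divr_gt0 e0 n1).
exists [seq (c * x.1, x.2) | x <- s].
have -> : sqdist (fun t => c * f t) (tpoly [seq (c * x.1, x.2) | x <- s]) =
    sqnorm c * sqdist f (tpoly s).
  rewrite /sqdist -rintZ; last by apply: L2_sqnorm; apply: L2B => //; exact: L2_tpoly.
  congr rint; apply/funext => t; rewrite -sqnormM mulrBr; congr (sqnorm (_ - _)).
  rewrite /tpoly big_map mulr_sumr; apply: eq_bigr => x _ /=.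
  by rewrite mulrA.
apply: le_trans (ler_wpM2l n0 fs) _.
rewrite mulrCA ler_piMr ?(ltW e0)// ler_pdivrMr// mul1r; lra.
Qed.

Lemma L2approx_closed f : L2 f ->
  (forall e : R, 0 < e -> exists2 g, L2approx g & sqdist f g <= e) -> L2approx f.
Proof.
move=> fL fa; split=> // e e0; have e4 : 0 < e / 4 by rewrite divr_gt0.
have [g [gL ga] fg] := fa _ e4; have [s gs] := ga _ e4; exists s.
have fgL := L2B fL gL; have gsL := L2B gL (L2_tpoly s).
apply: (@le_trans _ _ (2 * sqdist f g + 2 * sqdist g (tpoly s))); last lra.
rewrite /sqdist -!rintZ -?rintD; try exact: rintegrableZ; try exact: L2_sqnorm.
- apply: rint_le.
  + by apply: L2_sqnorm; apply: L2B => //; exact: L2_tpoly.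
  + by apply: rintegrableD; apply: rintegrableZ; exact: L2_sqnorm.
  + move=> t _; apply: le_trans (sqnormD _ _).
    by rewrite addrA subrK.
- by apply: rintegrableZ; exact: L2_sqnorm.
- by apply: rintegrableZ; exact: L2_sqnorm.
Qed.

Lemma L2approx_tpoly f : is_tpoly f -> L2approx f.
Proof.
move=> [s ->]; split; first exact: L2_tpoly.
move=> e e0; exists s; rewrite /sqdist.
have -> : (fun t => sqnorm (tpoly s t - tpoly s t)) = fun=> 0.
  by apply/funext => t; rewrite subrr sqnorm0.
by rewrite rint_cst mul0r ltW.
Qed.

Lemma sqnorm_real (a : R) : sqnorm a%:C = a ^+ 2.
Proof. by rewrite /sqnorm /= expr0n addr0. Qed.

Lemma cmeas_real (f : R -> R) : measurable_fun TT f -> cmeas (fun t => (f t)%:C).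
Proof. by move=> mf; split => //=; exact: measurable_cst. Qed.

Lemma L2approx_dominated (f_ : nat -> R -> R) (f G : R -> R) :
  (forall n, measurable_fun TT (f_ n)) -> (forall n, L2approx (fun t => (f_ n t)%:C)) ->
  L2 (fun t => (f t)%:C) ->
  (\forall t \ae mu, T t -> f_ n t @[n --> \oo] --> f t) ->
  rintegrable G -> (forall n t, T t -> (f t - f_ n t) ^+ 2 <= G t) ->
  L2approx (fun t => (f t)%:C).
Proof.
move=> mf_ fa fL cvf Gi fG; apply: L2approx_closed => // e e0.
have [mf _] := L2_cmeas fL; rewrite /= in mf.
have [|||||_] := @rint_dominated _ (fun n t => (f t - f_ n t) ^+ 2) (fun=> 0) G.
- by move=> n; apply: measurable_funX; apply: measurable_funB.
- exact: measurable_cst.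
- apply: ae_imp cvf => t H Tt.
  have : (f t - f_ n t) * (f t - f_ n t) @[n --> \oo] --> (f t - f t) * (f t - f t).
    by apply: cvgM; apply: cvgB; [exact: cvg_cst|exact: H|exact: cvg_cst|exact: H].
  rewrite subrr mulr0; congr (_ --> _).
- exact: Gi.
- by move=> n t Tt; rewrite ger0_norm ?sqr_ge0// fG.
rewrite rint_cst mul0r => /cvgrPdist_le /(_ _ e0) [n _ /(_ n (leqnn n))] /= H.
exists (fun t => (f_ n t)%:C) => //; apply: le_trans H.
rewrite sub0r normrN /sqdist.
have -> : (fun t => sqnorm ((f t)%:C - (f_ n t)%:C)) = fun t => (f t - f_ n t) ^+ 2.
  by apply/funext => t; rewrite -rmorphB sqnorm_real.
exact: ler_norm.
Qed.

Lemma L2approx_indic (S : set (measurableTypeR R)) : measurable S ->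
  L2approx (fun t => (\1_S t : R)%:C).
Proof.
move=> mS; refine (@indic_induction _ (fun f : R -> R => L2approx (fun t => (f t)%:C))
  _ _ _ _ S mS).
- by apply: L2approx_tpoly; exact: is_tpoly_cst.
- move=> f g fa ga; under [X in L2approx X]eq_fun do rewrite rmorphB -mulN1r.
  by apply: L2approxD => //; exact: L2approxZ.
- by move=> n x; apply: L2approx_tpoly; exact: is_tpoly_sharpen_bump.
- move=> f_ f fa mf_ mf f_01 f01 cvf.
  apply: (@L2approx_dominated f_ f (fun=> 1)) => //.
  + apply: (@L2_bounded); first exact: cmeas_real.
    apply: aeW => t _; rewrite sqnorm_real; have /andP[? ?] := f01 t.
    by rewrite exprn_ile1.
  + exact: rintegrable_cst.
  + move=> n t _; have /andP[? ?] := f01 t; have /andP[? ?] := f_01 n t.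
    by rewrite -real_normK ?num_real// exprn_ile1// ler_norml; apply/andP; split; lra.
Qed.

Lemma L2approx_sum (I : Type) (s : seq I) (F : I -> R -> C) :
  (forall i, L2approx (F i)) -> L2approx (fun t => \sum_(i <- s) F i t).
Proof.
move=> Fa; elim: s => [|i s IH].
  by under eq_fun do rewrite big_nil; apply: L2approx_tpoly; exact: is_tpoly_cst.
by under eq_fun do rewrite big_cons; exact: L2approxD.
Qed.

Import HBNNSimple.

Lemma L2approx_nnsfun (g : {nnsfun measurableTypeR R >-> R}) :
  L2approx (fun t => (g t)%:C).
Proof.
have -> : (fun t => (g t)%:C) =
    (fun t => \sum_(y <- finmap.enum_fset (fset_set (range g)))
      y%:C * (\1_(g @^-1` [set y]) t : R)%:C).
  apply/funext => t; rewrite {1}(fimfunE g t) fsbig_finite//= rmorph_sum /=.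
  by apply: eq_bigr => y _; rewrite rmorphM.
apply: L2approx_sum => y; apply: L2approxZ; apply: L2approx_indic.
exact: measurable_funPTI.
Qed.

Lemma L2approx_ge0 (f : R -> R) : (forall t, 0 <= f t) ->
  L2 (fun t => (f t)%:C) -> L2approx (fun t => (f t)%:C).
Proof.
move=> f0 fL; have [mf _] := L2_cmeas fL; rewrite /= in mf.
have mF : measurable_fun TT (EFin \o f) by exact/measurable_EFinP.
have F0 (t : measurableTypeR R) : TT t -> (0 <= (EFin \o f) t)%E.
  by move=> _; rewrite lee_fin.
pose g_ := nnsfun_approx (@measurable_Tdom R) mF.
have gf n t : T t -> g_ n t <= f t.
  move=> Tt; rewrite -lee_fin /g_ nnsfun_approxE.
  exact: (@le_approx _ _ _ TT (EFin \o f) n t F0 Tt).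
(* The simple functions increase to [f] from below, so the squared error stays below [f ^+ 2]. *)
apply: (@L2approx_dominated (fun n => g_ n) f (fun t => f t ^+ 2)) => //.
- by move=> n; apply: measurable_funTS.
- by move=> n; exact: L2approx_nnsfun.
- apply: aeW => t Tt.
  have := @cvg_nnsfun_approx _ _ _ TT (@measurable_Tdom R) _ mF F0 t Tt.
  by move/fine_cvgP => [].
- by have := L2_sqnorm fL; under eq_fun do rewrite sqnorm_real.
- move=> n t Tt; rewrite ler_sqr ?nnegrE ?subr_ge0 ?gf//.
  by rewrite lerBlDr lerDl.
Qed.

Lemma L2approx_real (f : R -> R) : L2 (fun t => (f t)%:C) ->
  L2approx (fun t => (f t)%:C).
Proof.
move=> fL; have [mf _] := L2_cmeas fL; rewrite /= in mf.
have H (g : R -> R) : measurable_fun TT g -> (forall t, 0 <= g t <= `|f t|) ->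
    L2approx (fun t => (g t)%:C).
  move=> mg gf; apply: L2approx_ge0; first by move=> t; have /andP[] := gf t.
  apply: (L2_ae_le (cmeas_real mg) (L2_sqnorm fL)); apply: aeW => t _.
  have /andP[g0 ?] := gf t; rewrite !sqnorm_real -(real_normK (num_real (f t))).
  by rewrite ler_sqr ?nnegrE.
have -> : (fun t => (f t)%:C) =
    (fun t => (Num.max (f t) 0)%:C + -1 * (Num.max (- f t) 0)%:C).
  apply/funext => t; rewrite mulN1r -rmorphB; congr (_%:C).
  by have [h|h] := leP 0 (f t); rewrite /Num.max; do !case: ifP => //; lra.
apply: L2approxD; last apply: L2approxZ.
- apply: H; first by apply: measurable_maxr => //; exact: measurable_cst.
  by move=> t; rewrite le_max lexx orbT ge_max ler_norm normr_ge0.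
- apply: H.
    by apply: measurable_maxr; [exact: measurable_funN|exact: measurable_cst].
  by move=> t; rewrite le_max lexx orbT ge_max -[`|f t|]normrN ler_norm normr_ge0.
Qed.

Lemma L2_L2approx f : L2 f -> L2approx f.
Proof.
move=> fL; have [m1 m2] := L2_cmeas fL.
have -> : f = (fun t => (cre (f t))%:C + Complex 0 1 * (cim (f t))%:C).
  by apply/funext => t; apply: complexE; rewrite !(creD, cimD, creM, cimM) /=; ring.
have H (g : R -> R) : measurable_fun TT g -> (forall t, g t ^+ 2 <= sqnorm (f t)) ->
    L2 (fun t => (g t)%:C).
  move=> mg gf; apply: (L2_ae_le (cmeas_real mg) (L2_sqnorm fL)).
  by apply: aeW => t _; rewrite sqnorm_real.
apply: L2approxD; last apply: L2approxZ; apply: L2approx_real; apply: H => // t.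
- by rewrite lerDl sqr_ge0.
- by rewrite lerDr sqr_ge0.
Qed.

End L2Density.

(** * Orthogonality of functions with disjoint spectra *)

Section Parseval.
Set Implicit Arguments.
Unset Strict Implicit.
Local Open Scope classical_set_scope.
Local Open Scope complex_scope.
Variable R : realType.
Local Notation C := R[i].
Local Notation mu := (@lebesgue_measure R).
Local Notation T := (@Tdom R).
Local Notation TT := (T : set (measurableTypeR R)).
Implicit Types f g h : R -> C.

Lemma rint_derive (F f : R -> R) : (forall t : R, is_derive t 1 F (f t)) ->
  continuous f -> rint f = F (2 * pi) - F 0.
Proof.
move=> dF cf.
have cF : continuous F.
  move=> t; apply/differentiable_continuous/derivable1_diffP.
  by have [] := dF t.
rewrite /rint /Rintegral /Tdom (@continuous_FTC2 R f F) ?EFinB//.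
- exact: pi2_gt0.
- exact: continuous_subspaceT.
- split; first by move=> t _; have [] := dF t.
  + by apply: cvg_at_right_filter; exact: cF.
  + by apply: cvg_at_left_filter; exact: cF.
- by move=> t _; rewrite derive1E; have [_ ->] := dF t.
Qed.

Lemma expi_2pi (n : int) : expi (n%:~R * (2 * pi)) = 1 :> C.
Proof.
have e1 : expi (2 * pi) = 1 :> C.
  by apply: complexE; rewrite /= mulr_natl ?cos2pi ?sin2pi.
have en (k : nat) : expi (k%:R * (2 * pi)) = 1 :> C.
  elim: k => [|k IH]; first by rewrite mul0r expi0.
  by rewrite -natr1 mulrDl mul1r expiD IH e1 mulr1.
case: n => k; first exact: en.
by rewrite NegzE rmorphN /= mulNr -cconj_expi en cconj1.
Qed.

(** The antiderivatives [sin (n t) / n] and [- cos (n t) / n] take equal values at both ends of the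
    interval, by [expi_2pi]. *)
Lemma cint_expi (n : int) : n != 0 -> cint (fun t => expi (n%:~R * t)) = 0 :> C.
Proof.
move=> n0; set a : R := n%:~R; have a0 : a != 0 by rewrite intr_eq0.
have /(congr1 (fun z => (cre z, cim z))) [ca sa] := expi_2pi n.
rewrite -/a in ca sa.
have da (t : R) : is_derive t 1 (fun t : R => a * t) a.
  apply: (is_derive_eq (@is_deriveZ R R^o R^o id a t 1 _ (is_derive_id t 1))).
  exact: mulr1.
have cta : continuous (fun t : R => a * t).
  by move=> t; apply: cvgM; [exact: cvg_cst|exact: cvg_id].
apply: complexE => /=.
- have dF (t : R) : is_derive t 1 (fun t => a^-1 * sin (a * t)) (cos (a * t)).
    apply: (is_derive_eq (@is_deriveZ R R^o R^o _ a^-1 t 1 _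
      (is_derive1_comp (is_derive_sin _) (da t)))).
    by rewrite /GRing.scale /= mulrCA mulVf// mulr1.
  have cf : continuous (fun t : R => cos (a * t)).
    by move=> t; apply: continuous_comp; [exact: cta|exact: continuous_cos].
  by rewrite (rint_derive dF cf) sa !mulr0 sin0 mulr0 subrr.
- have dF (t : R) : is_derive t 1 (fun t => - a^-1 * cos (a * t)) (sin (a * t)).
    apply: (is_derive_eq (@is_deriveZ R R^o R^o _ (- a^-1) t 1 _
      (is_derive1_comp (is_derive_cos _) (da t)))).
    by rewrite /GRing.scale /= mulNr mulNr mulrN opprK mulrCA mulVf// mulr1.
  have cf : continuous (fun t : R => sin (a * t)).
    by move=> t; apply: continuous_comp; [exact: cta|exact: continuous_sin].
  by rewrite (rint_derive dF cf) ca mulr0 cos0 subrr.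
Qed.

Lemma cint_cst0 : cint (fun=> 0) = 0 :> C.
Proof. by apply: complexE; rewrite /= rint_cst mul0r. Qed.

Lemma cint_mul_tpoly f s : L2 f ->
  (forall x, x \in s -> cint (fun t => f t * expi (x.2%:~R * t)) = 0) ->
  cint (fun t => f t * tpoly s t) = 0.
Proof.
move=> fL; elim: s => [|x s IH] fs.
  rewrite -[RHS]cint_cst0; congr cint; apply/funext => t.
  by rewrite tpoly_nil mulr0.
have -> : (fun t => f t * tpoly (x :: s) t) =
    (fun t => x.1 * (f t * expi (x.2%:~R * t)) + f t * tpoly s t).
  by apply/funext => t; rewrite tpoly_cons; ring.
have i1 : cintegrable (fun t => f t * expi (x.2%:~R * t)).
  by apply: L2_cintegrableM => //; exact: L2_expi.
rewrite cintD; [|exact: cintegrableZ|].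
  rewrite cintZ// fs ?mem_head// mulr0 add0r IH// => y ys.
  by apply: fs; rewrite in_cons ys orbT.
by apply: L2_cintegrableM => //; exact: L2_tpoly.
Qed.

(* AM-GM in place of the Cauchy-Schwarz inequality *)
Lemma cre_cint_le f g (e : R) : L2 f -> L2 g -> 0 < e ->
  `|cre (cint (fun t => f t * g t))| <=
  e^-1 * rint (fun t => sqnorm (f t)) + e * rint (fun t => sqnorm (g t)).
Proof.
move=> fL gL e0; have [fi gi] := (L2_sqnorm fL, L2_sqnorm gL).
have [fgi _] := L2_cintegrableM fL gL.
have H t : `|cre (f t * g t)| <= e^-1 * sqnorm (f t) + e * sqnorm (g t).
  rewrite creM /sqnorm; move: (cre _) (cim _) (cre _) (cim _) => c d a b.
  have H (x y : R) : 0 <= e^-1 * x ^+ 2 + e * y ^+ 2 - 2 * (x * y).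
    have -> : e^-1 * x ^+ 2 + e * y ^+ 2 - 2 * (x * y) = e^-1 * (x - e * y) ^+ 2.
      by field; rewrite gt_eqF.
    by rewrite mulr_ge0 ?sqr_ge0 ?invr_ge0 ?ltW.
  have H1 := H a c; have H2 := H b d; have H3 := H a (- c); have H4 := H b (- d).
  have := mulr_ge0 (ltW e0) (sqr_ge0 c); have := mulr_ge0 (ltW e0) (sqr_ge0 d).
  have ei : 0 <= e^-1 by rewrite invr_ge0 ltW.
  have := mulr_ge0 ei (sqr_ge0 a); have := mulr_ge0 ei (sqr_ge0 b).
  rewrite !sqrrN in H3 H4; rewrite ler_norml.
  move: H1 H2 H3 H4; move: e^-1 => i H1 H2 H3 H4 a2 b2 c2 d2.
  by apply/andP; split; lra.
rewrite -!rintZ// -rintD; [|exact: rintegrableZ..].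
have Gi : rintegrable (fun t => e^-1 * sqnorm (f t) + e * sqnorm (g t)).
  by apply: rintegrableD; exact: rintegrableZ.
rewrite /= ler_norml -[- rint _]mulN1r -rintZ//; apply/andP; split.
- apply: rint_le => //; first exact: rintegrableZ.
  by move=> t _; have := H t; rewrite mulN1r ler_norml => /andP[].
- by apply: rint_le => // t _; have := H t; rewrite ler_norml => /andP[].
Qed.

(** Approximate [f] by a polynomial and split its list: [s1] keeps the frequencies that integrate to
    0 against [g], [s2] the others. Subtracting [s1] from [f] leaves the integral unchanged. As [s2]
    is orthogonal to both [f] and [s1], dropping it does not worsen the approximation. Hence
    [f - s1] is small and the integral is at most any positive [d]. *)
Lemma cre_cint_mul_eq0 f g : L2 f -> L2 g ->
  (forall n : int, cint (fun t => f t * expi ((- n)%:~R * t)) = 0 \/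
                   cint (fun t => g t * expi (n%:~R * t)) = 0) ->
  cre (cint (fun t => f t * g t)) = 0.
Proof.
move=> fL gL fg; apply/eqP; rewrite -normr_eq0 eq_le normr_ge0 andbT.
apply/ler_addgt0Pr => d d0; rewrite add0r.
set G := rint (fun t => sqnorm (g t)).
have G0 : 0 <= G by apply: rint_ge0 => t; exact: sqnorm_ge0.
(* With squared distance at most [e * e], the final bound is
   [e^-1 * (e * e) + e * G = e * (1 + G) = d]. *)
pose e := d / (1 + G); have G1 : 0 < 1 + G by lra.
have e0 : 0 < e by rewrite divr_gt0.
have [_ /(_ _ (mulr_gt0 e0 e0)) [s fs]] := L2_L2approx fL.
pose P (x : C * int) := cint (fun t => g t * expi (x.2%:~R * t)) == 0.
pose s1 := [seq x <- s | P x]; pose s2 := [seq x <- s | ~~ P x].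
have sE t : tpoly s t = tpoly s1 t + tpoly s2 t.
  by rewrite /tpoly -big_cat; apply: perm_big; rewrite perm_sym (perm_filterC P).
have aL := L2B fL (L2_tpoly s1).
have -> : cint (fun t => f t * g t) = cint (fun t => (f t - tpoly s1 t) * g t).
  have -> : (fun t => (f t - tpoly s1 t) * g t) =
      (fun t => f t * g t - g t * tpoly s1 t).
    by apply/funext => t; rewrite mulrBl [g t * _]mulrC.
  rewrite cintB; [|exact: L2_cintegrableM|exact: L2_cintegrableM gL (L2_tpoly _)].
  rewrite cint_mul_tpoly ?subr0// => x.
  by rewrite mem_filter => /andP[/eqP].
apply: le_trans (cre_cint_le aL gL e0) _; rewrite -/G.
have orth : cint (fun t => (f t - tpoly s1 t) * cconj (tpoly s2 t)) = 0.
  have -> : (fun t => (f t - tpoly s1 t) * cconj (tpoly s2 t)) = (fun t =>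
      (f t - tpoly s1 t) * tpoly [seq (cconj x.1, - x.2) | x <- s2] t).
    apply/funext => t; congr (_ * _); elim: (s2) => [|x s' IH].
      by rewrite !tpoly_nil cconj0.
    by rewrite /= !tpoly_cons cconjD IH cconjM cconj_expi /= rmorphN mulNr.
  apply: cint_mul_tpoly => // _ /mapP[[c n] /[!mem_filter] /andP[Pn _] ->] /=.
  (* The second alternative would have placed [n] in [s1], so the coefficient of [f] vanishes. *)
  have [f0|/eqP gn] := fg n; last by rewrite /P /= gn in Pn.
  have -> : (fun t => (f t - tpoly s1 t) * expi ((- n)%:~R * t)) = (fun t =>
      f t * expi ((- n)%:~R * t) - expi ((- n)%:~R * t) * tpoly s1 t).
    by apply/funext => t; rewrite mulrBl [_ * tpoly _ _]mulrC.
  have eL := L2_expi (- n)%:~R.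
  rewrite cintB; [|exact: L2_cintegrableM|]; last first.
    by apply: L2_cintegrableM => //; exact: L2_tpoly.
  rewrite f0 cint_mul_tpoly ?subr0// => -[c' m]; rewrite mem_filter => /andP[Pm _] /=.
  (* [P] depends on the frequency alone, so [s1] and [s2] share none and are orthogonal. *)
  have mn : m - n != 0.
    by apply: contraNneq Pn => /eqP; rewrite subr_eq0 => /eqP <-.
  rewrite -[RHS](cint_expi mn); congr cint; apply/funext => t.
  by rewrite -expiD addrC -mulrDl -intrD.
have pyth : rint (fun t => sqnorm (f t - tpoly s1 t)) <= sqdist f (tpoly s).
  have ai := L2_sqnorm aL; have bi := L2_sqnorm (L2_tpoly s2).
  have [ci _] := L2_cintegrableM aL (L2_conj (L2_tpoly s2)).
  have -> : sqdist f (tpoly s) = rint (fun t => (sqnorm (f t - tpoly s1 t)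
      + sqnorm (tpoly s2 t)) - 2 * cre ((f t - tpoly s1 t) * cconj (tpoly s2 t))).
    congr rint; apply/funext => t; rewrite sE opprD addrA.
    move: (f t - _) (tpoly s2 t) => z w.
    by rewrite /sqnorm creM /= creD cimD creN cimN; ring.
  rewrite rintB; [|exact: rintegrableD|exact: rintegrableZ].
  rewrite rintZ// (congr1 (@cre R) orth : rint _ = 0) mulr0 subr0 rintD// lerDl.
  by apply: rint_ge0 => t; exact: sqnorm_ge0.
apply: (@le_trans _ _ (e^-1 * (e * e) + e * G)).
  rewrite lerD2r ler_wpM2l ?invr_ge0 ?(ltW e0)//; exact: le_trans pyth fs.
by rewrite mulKf ?gt_eqF// /e -{1}[d / _]mulr1 -mulrDr divfK// gt_eqF.
Qed.

(* Parseval's identity when the spectra of [f] and [conj g] are disjoint *)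
Lemma cint_mul_eq0 f g : L2 f -> L2 g ->
  (forall n : int, cint (fun t => f t * expi ((- n)%:~R * t)) = 0 \/
                   cint (fun t => g t * expi (n%:~R * t)) = 0) ->
  cint (fun t => f t * g t) = 0.
Proof.
move=> fL gL fg; apply: complexE; first exact: cre_cint_mul_eq0.
(* Multiplying by the imaginary unit turns the imaginary part into minus the real part and keeps the
   spectrum. *)
have := @cre_cint_mul_eq0 f (fun t => Complex 0 1 * g t) fL (L2Z _ gL).
have -> : (fun t => f t * (Complex 0 1 * g t)) =
    (fun t => Complex 0 1 * (f t * g t)) by apply/funext => t; ring.
rewrite cintZ; last exact: L2_cintegrableM.
rewrite creM mul0r mul1r add0r => /(_ _)/eqP; rewrite oppr_eq0 => H; apply/eqP/H.
move=> n; have [|gn] := fg n; [by left|right].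
have -> : (fun t => Complex 0 1 * g t * expi (n%:~R * t)) =
    (fun t => Complex 0 1 * (g t * expi (n%:~R * t))) by apply/funext => t; ring.
rewrite cintZ ?gn ?mulr0//.
by apply: L2_cintegrableM => //; exact: L2_expi.
Qed.

End Parseval.

(** * Hardy space, inner functions and model spaces *)

Section Hardy.
Set Implicit Arguments.
Unset Strict Implicit.
Local Open Scope classical_set_scope.
Local Open Scope complex_scope.
Variable R : realType.
Local Notation C := R[i].
Local Notation mu := (@lebesgue_measure R).
Local Notation T := (@Tdom R).
Local Notation TT := (T : set (measurableTypeR R)).
Implicit Types f g h a b k : R -> C.

Lemma aeqT_sym f g : aeqT f g -> aeqT g f.
Proof. by move=> /aeqTP fg; apply/aeqTP; apply: ae_imp fg => t H /H. Qed.

Lemma aeqT_refl f : aeqT f f.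
Proof. by apply/aeqTP; exact: aeW. Qed.

Lemma ipZl (c : C) f g : L2 f -> L2 g -> ip (fun t => c * f t) g = c * ip f g.
Proof.
move=> fL gL; rewrite !ipE mulrCA -(cintZ c).
  by congr (_ * _); congr cint; apply/funext => t; rewrite mulrA.
by apply: L2_cintegrableM => //; exact: L2_conj.
Qed.

Lemma ipDl f g h : L2 f -> L2 g -> L2 h ->
  ip (fun t => f t + g t) h = ip f h + ip g h.
Proof.
move=> fL gL hL; rewrite !ipE -mulrDr -cintD.
- by congr (_ * _); congr cint; apply/funext => t; rewrite mulrDl.
- by apply: L2_cintegrableM => //; exact: L2_conj.
- by apply: L2_cintegrableM => //; exact: L2_conj.
Qed.

Lemma ipBl f g h : L2 f -> L2 g -> L2 h ->
  ip (fun t => f t - g t) h = ip f h - ip g h.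
Proof.
move=> fL gL hL; rewrite !ipE -mulrBr -cintB.
- by congr (_ * _); congr cint; apply/funext => t; rewrite mulrBl.
- by apply: L2_cintegrableM => //; exact: L2_conj.
- by apply: L2_cintegrableM => //; exact: L2_conj.
Qed.

Lemma ip_sym f g : L2 f -> L2 g -> ip g f = cconj (ip f g).
Proof.
move=> fL gL; rewrite !ipE cconjM -cint_conj; last first.
  by apply: L2_cintegrableM => //; exact: L2_conj.
congr (_ * _); first by rewrite /cconj /= oppr0.
by congr cint; apply/funext => t; rewrite cconjM cconjK mulrC.
Qed.

Lemma ip_sym_eq0 f g : L2 f -> L2 g -> ip f g = 0 -> ip g f = 0.
Proof. by move=> fL gL fg; rewrite ip_sym// fg cconj0. Qed.

Lemma ipDr f g h : L2 f -> L2 g -> L2 h ->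
  ip h (fun t => f t + g t) = ip h f + ip h g.
Proof.
move=> fL gL hL; rewrite [LHS]ip_sym//; last exact: L2D.
by rewrite ipDl// cconjD -!ip_sym.
Qed.

Lemma ipZr (c : C) f g : L2 f -> L2 g ->
  ip g (fun t => c * f t) = cconj c * ip g f.
Proof.
move=> fL gL; rewrite [LHS]ip_sym//; last exact: L2Z.
by rewrite ipZl// cconjM -ip_sym.
Qed.

Lemma ip_ae f f' g g' : L2 f -> L2 f' -> L2 g -> L2 g' ->
  aeqT f f' -> aeqT g g' -> ip f g = ip f' g'.
Proof.
move=> fL fL' gL gL' /aeqTP ff /aeqTP gg; rewrite !ipE; congr (_ * _).
apply: cint_ae.
- by apply: cmeasM; [exact: L2_cmeas|exact/cmeas_conj/L2_cmeas].
- by apply: cmeasM; [exact: L2_cmeas|exact/cmeas_conj/L2_cmeas].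
- by apply/aeqTP; apply: ae_imp2 ff gg => t H K Tt; rewrite H// K.
Qed.

Lemma ip_self_eq0 f : L2 f -> ip f f = 0 -> aeqT f (fun=> 0).
Proof.
move=> fL /ip_eq0 /(congr1 (@cre R)) /= f0; apply/aeqTP.
apply: ae_imp (rint_eq0_ae (L2_sqnorm fL) _ _).
- by move=> t H /H /sqnorm_eq0.
- by move=> t; exact: sqnorm_ge0.
- by rewrite -[RHS]f0; congr rint; apply/funext => t; rewrite mul_conj.
Qed.

Lemma ip_chi f g : ip (fun t => chi t * f t) (fun t => chi t * g t) = ip f g.
Proof.
rewrite !ipE; congr (_ * _); congr cint; apply/funext => t.
by rewrite cconjM mulrACA expi_conj mul1r.
Qed.

Lemma chi_chibar f t : chi t * chibar f t = f t.
Proof. by rewrite /chibar mulrA expi_conj mul1r. Qed.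

Lemma chiE t : chi t = expi (1 * t) :> C. Proof. by rewrite mul1r. Qed.

Lemma L2_chi f : L2 f -> L2 (fun t => chi t * f t).
Proof.
move=> fL; under [X in L2 X]eq_fun do rewrite chiE; apply: L2M_bounded => //.
  exact: cmeas_expi.
by apply: aeW => t _; rewrite sqnorm_expi.
Qed.

Lemma L2_chibar f : L2 f -> L2 (chibar f).
Proof.
move=> fL; have -> : chibar f = (fun t => expi ((-1) * t) * f t).
  by apply/funext => t; rewrite /chibar cconj_expi mulN1r.
apply: L2M_bounded => //; first exact: cmeas_expi.
by apply: aeW => t _; rewrite sqnorm_expi.
Qed.

Lemma ip_chibar f g : L2 f -> L2 g -> ip f (chibar g) = ip (fun t => chi t * f t) g.
Proof.
move=> fL gL; rewrite -ip_chi; congr ip.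
by apply/funext => t; rewrite chi_chibar.
Qed.

Lemma H2P f : H2 f <-> L2 f /\
  forall n : int, 0 < n -> cint (fun t => f t * expi (n%:~R * t)) = 0.
Proof.
split=> -[fL fn]; split=> // n n0.
- by rewrite -[n]opprK; apply/fourier_eq0; apply: fn; rewrite oppr_lt0.
- by apply/fourier_eq0; apply: fn; rewrite oppr_gt0.
Qed.

Lemma H2_L2 f : H2 f -> L2 f. Proof. by case. Qed.

Lemma at0E f : at0 f = ip f (@Defs.one R).
Proof.
by rewrite /at0 /fourier; congr ip; apply/funext => t; rewrite mul0r expi0.
Qed.

Lemma at0_eq0 f : at0 f = 0 <-> cint f = 0.
Proof.
rewrite at0E ip_eq0; suff -> : (fun t => f t * cconj (Defs.one t)) = f by [].
by apply/funext => t; rewrite /Defs.one cconj1 mulr1.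
Qed.

Lemma H2D f g : H2 f -> H2 g -> H2 (fun t => f t + g t).
Proof.
move=> /H2P[fL fn] /H2P[gL gn]; apply/H2P; split=> [|n n0]; first exact: L2D.
have -> : (fun t => (f t + g t) * expi (n%:~R * t)) =
  (fun t => f t * expi (n%:~R * t) + g t * expi (n%:~R * t)).
  by apply/funext => t; rewrite mulrDl.
have eL := @L2_expi R n%:~R.
by rewrite cintD ?fn ?gn ?addr0//; exact: L2_cintegrableM.
Qed.

Lemma H2Z (c : C) f : H2 f -> H2 (fun t => c * f t).
Proof.
move=> /H2P[fL fn]; apply/H2P; split=> [|n n0]; first exact: L2Z.
have -> : (fun t => c * f t * expi (n%:~R * t)) =
  (fun t => c * (f t * expi (n%:~R * t))).
  by apply/funext => t; rewrite mulrA.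
have eL := @L2_expi R n%:~R.
by rewrite cintZ ?fn ?mulr0//; exact: L2_cintegrableM.
Qed.

Lemma H2B f g : H2 f -> H2 g -> H2 (fun t => f t - g t).
Proof.
move=> fH gH; have := H2D fH (H2Z (-1) gH).
by under eq_fun do rewrite mulN1r.
Qed.

Lemma H2_cst (c : C) : H2 (fun=> c).
Proof.
apply/H2P; split=> [|n n0]; first exact: L2_cst.
rewrite cintZ; first by rewrite cint_expi ?mulr0// gt_eqF.
exact/L2_cintegrable/L2_expi.
Qed.

Lemma H2_ae f g : cmeas g -> aeqT f g -> H2 f -> H2 g.
Proof.
move=> mg fg [fL fn]; have gL := L2_ae mg fg fL; split=> // n n0.
rewrite -[RHS](fn n n0); apply: ip_ae => //; try exact: L2_expi.
- exact: aeqT_sym.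
- exact: aeqT_refl.
Qed.

(* For [m > 0] every frequency lies outside the spectrum of one of the factors. *)
Lemma cint_H2_mul a b (m : int) : H2 a -> H2 b -> 0 < m ->
  cint (fun t => a t * b t * expi (m%:~R * t)) = 0.
Proof.
move=> /H2P[aL an] /H2P[bL bn] m0.
have -> : (fun t => a t * b t * expi (m%:~R * t)) =
    (fun t => a t * (b t * expi (m%:~R * t))).
  by apply/funext => t; rewrite mulrA.
have beL : L2 (fun t => b t * expi (m%:~R * t)).
  under [X in L2 X]eq_fun do rewrite mulrC; apply: L2M_bounded => //.
    exact: cmeas_expi.
  by apply: aeW => t _; rewrite sqnorm_expi.
apply: cint_mul_eq0 => // n; have [n0|n0] := ltP n 0.
  by left; apply: an; rewrite oppr_gt0.
right; rewrite -[RHS](bn (m + n)); last exact: ltr_pwDl.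
congr cint; apply/funext => t.
by rewrite intrD mulrDl expiD mulrA.
Qed.

Lemma H2_chi f : H2 f -> H2 (fun t => chi t * f t).
Proof.
move=> /H2P[fL fn]; apply/H2P; split=> [|n n0]; first exact: L2_chi.
rewrite -[RHS](fn (n + 1)); last exact: addr_gt0.
congr cint; apply/funext => t.
by rewrite intrD mulrDl expiD chiE; ring.
Qed.

(** Dividing by [chi] moves every coefficient down by one, so the only new constraint is on the
    coefficient of index 0, the case [n = 1] below. *)
Lemma H2_chibar f : H2 f -> at0 f = 0 -> H2 (chibar f).
Proof.
move=> /H2P[fL fn] /at0_eq0 f0; apply/H2P; split=> [|n n0]; first exact: L2_chibar.
have e : (fun t => chibar f t * expi (n%:~R * t)) =
    (fun t => f t * expi ((n - 1)%:~R * t)).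
  apply/funext => t; rewrite intrD mulrDl expiD /chibar cconj_expi.
  by rewrite mulrN1z mulN1r; ring.
have [n1|n1] := ltP 1 n; first by rewrite e fn// subr_gt0.
rewrite e; have -> : n = 1 by apply/eqP; rewrite eq_le n1 -gtz0_ge1.
rewrite -[RHS]f0; congr cint; apply/funext => t.
by rewrite subrr mul0r expi0 mulr1.
Qed.

(** Evaluation at the origin is multiplicative; here a factor [chi] is pulled out of [a], which
    reduces the claim to a negative coefficient of a product in [H2]. *)
Lemma at0_H2_mul a b : H2 a -> H2 b -> at0 a = 0 -> cint (fun t => a t * b t) = 0.
Proof.
move=> aH bH a0; have := @cint_H2_mul (chibar a) b 1 (H2_chibar aH a0) bH isT.
congr (cint _ = _); apply/funext => t.
by rewrite -[in RHS](chi_chibar a t) chiE mulr1z; ring.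
Qed.

Section Inner.
Variable th : R -> C.
Hypothesis thI : inner th.

Lemma inner_cmeas : cmeas th. Proof. by case: thI. Qed.

Lemma inner_ae : \forall t \ae mu, T t -> sqnorm (th t) = 1.
Proof.
case: thI => _ _ H _; rewrite /almost_everywhere; apply: negligibleS H => t /=.
by move=> /not_implyP.
Qed.

Lemma L2_innerM f : L2 f -> L2 (fun t => th t * f t).
Proof.
apply: L2M_bounded; first exact: inner_cmeas.
by apply: ae_imp inner_ae => t H /H ->.
Qed.

Lemma inner_H2 : H2 th.
Proof.
split; last by case: thI.
apply: L2_bounded; first exact: inner_cmeas.
by apply: ae_imp inner_ae => t H /H ->.
Qed.

Lemma H2_innerM h : H2 h -> H2 (fun t => th t * h t).
Proof.
move=> hH; apply/H2P; split=> [|n n0]; first exact/L2_innerM/H2_L2.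
by apply: cint_H2_mul => //; exact: inner_H2.
Qed.

Lemma ip_innerM f g : L2 f -> L2 g ->
  ip (fun t => th t * f t) (fun t => th t * g t) = ip f g.
Proof.
move=> fL gL; rewrite !ipE; congr (_ * _).
have fgm : cmeas (fun t => f t * cconj (g t)).
  by apply: cmeasM; [exact: L2_cmeas|exact/cmeas_conj/L2_cmeas].
have e : (fun t => th t * f t * cconj (th t * g t)) =
    (fun t => th t * cconj (th t) * (f t * cconj (g t))).
  by apply/funext => t; rewrite cconjM mulrACA.
rewrite e; apply: cint_ae => //.
  apply: cmeasM => //; apply: cmeasM; first exact: inner_cmeas.
  by apply: cmeas_conj; exact: inner_cmeas.
by apply/aeqTP; apply: ae_imp inner_ae => t H Tt; rewrite mul_conj H// mul1r.
Qed.

Lemma K_H2 f : Kspace th f -> H2 f. Proof. by case. Qed.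
Lemma K_L2 f : Kspace th f -> L2 f. Proof. by move=> /K_H2 /H2_L2. Qed.

Lemma K_ae f g : cmeas g -> aeqT f g -> Kspace th f -> Kspace th g.
Proof.
move=> mg fg [fH fK]; have gH := H2_ae mg fg fH; split=> // h hH.
rewrite -[RHS](fK h hH); apply: ip_ae.
1,2: exact: H2_L2.
1,2: exact/L2_innerM/H2_L2.
- exact: aeqT_sym.
- exact: aeqT_refl.
Qed.

Lemma KD f g : Kspace th f -> Kspace th g -> Kspace th (fun t => f t + g t).
Proof.
move=> [fH fK] [gH gK]; split=> [|h hH]; first exact: H2D.
by rewrite ipDl ?fK ?gK ?addr0//; [exact: H2_L2..|exact/L2_innerM/H2_L2].
Qed.

Lemma KZ (c : C) f : Kspace th f -> Kspace th (fun t => c * f t).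
Proof.
move=> [fH fK]; split=> [|h hH]; first exact: H2Z.
by rewrite ipZl ?fK ?mulr0//; [exact: H2_L2|exact/L2_innerM/H2_L2].
Qed.

Lemma KB f g : Kspace th f -> Kspace th g -> Kspace th (fun t => f t - g t).
Proof.
move=> fK gK; have := KD fK (KZ (-1) gK).
by under eq_fun do rewrite mulN1r.
Qed.

Lemma K_chibar k : H2 k -> at0 k = 0 ->
  (forall h, H2 h -> ip k (fun t => th t * (chi t * h t)) = 0) ->
  Kspace th (chibar k).
Proof.
move=> kH k0 kK; split=> [|h hH]; first exact: H2_chibar.
rewrite -[RHS](kK h hH) -(ip_chi (chibar k)) (funext (chi_chibar k)).
suff -> : (fun t => chi t * (th t * h t)) = (fun t => th t * (chi t * h t)) by [].
by apply/funext => t; rewrite mulrCA.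
Qed.

Lemma ip_K_inner f : Kspace th f -> ip f th = 0.
Proof.
move=> [_ fK]; rewrite -[RHS](fK _ (H2_cst 1)); congr ip.
by apply/funext => t; rewrite mulr1.
Qed.

Hypothesis th0 : at0 th = 0.

Lemma ip_innerM_one h : H2 h -> ip (fun t => th t * h t) (@Defs.one R) = 0.
Proof.
move=> hH; apply/ip_eq0; rewrite -[RHS](at0_H2_mul inner_H2 hH th0).
by congr cint; apply/funext => t; rewrite /Defs.one cconj1 mulr1.
Qed.

Lemma K_one : Kspace th (@Defs.one R).
Proof.
split=> [|h hH]; first exact: H2_cst.
apply: ip_sym_eq0; [exact/L2_innerM/H2_L2|exact: L2_cst|].
exact: ip_innerM_one.
Qed.

Lemma ip_one_one : ip (@Defs.one R) (@Defs.one R) = 1.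
Proof.
rewrite ipE; have -> : (fun t => Defs.one t * cconj (Defs.one t)) = fun=> 1 :> C.
  by apply/funext => t; rewrite /Defs.one cconj1 mulr1.
apply: complexE; rewrite ?creM ?cimM /= !rint_cst !mul0r ?subr0 ?mul1r.
  by rewrite mulVf// gt_eqF// pi2_gt0.
by rewrite mulr0 addr0.
Qed.

Lemma H2_shift h : H2 h -> exists2 h1, H2 h1 &
  forall t, h t = at0 h * Defs.one t + chi t * h1 t.
Proof.
move=> hH; exists (chibar (fun t => h t - at0 h * Defs.one t)); last first.
  by move=> t; rewrite chi_chibar addrC subrK.
have oH : H2 (fun t : R => at0 h * Defs.one t) by apply: H2Z; exact: H2_cst.
apply: H2_chibar; first exact: H2B.
rewrite at0E ipBl; [|exact: H2_L2..|exact: L2_cst].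
by rewrite ipZl ?ip_one_one ?mulr1 -?at0E ?subrr//; exact: L2_cst.
Qed.

(** The explicit projection of [chi * f]. For [f] in the model space, [chi * f] is already
    orthogonal to [th * chi * H2], so within [th * H2] only its component along [th] remains, with
    coefficient [(chi * f, th) = (f, chibar th)]. *)
Definition shiftK f t : C := chi t * f t - ip f (chibar th) * th t.

Lemma K_shiftK f : Kspace th f -> Kspace th (shiftK f).
Proof.
move=> fK; have [fH f0] := fK; have fL := H2_L2 fH; have thL := H2_L2 inner_H2.
have xL := L2_chi fL; have oL := @L2_cst R 1.
split=> [|h hH].
  by apply: H2B; [exact: H2_chi|apply: H2Z; exact: inner_H2].
(* The constant part of [h] is where the rank-one correction acts; the part divisible by [chi]
   reduces to the orthogonality of [f]. *)
have [h1 h1H hE] := H2_shift hH; have h1L := H2_L2 h1H.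
have thhL := L2_innerM (H2_L2 hH).
rewrite ipBl//; last exact: L2Z.
have -> : ip (fun t => ip f (chibar th) * th t) (fun t => th t * h t) =
    ip f (chibar th) * cconj (at0 h).
  rewrite ipZl//; congr (_ * _).
  rewrite at0E -ip_sym//; last exact: H2_L2.
  rewrite -(@ip_innerM (@Defs.one R) h)//; last exact: H2_L2.
  suff -> : (fun t => th t * Defs.one t) = th by [].
  by apply/funext => t; rewrite mulr1.
have -> : (fun t => th t * h t) =
    (fun t => at0 h * th t + chi t * (th t * h1 t)).
  by apply/funext => t; rewrite hE /Defs.one; ring.
have tL := L2_innerM h1L.
rewrite ipDr//; [|exact: L2Z|exact: L2_chi].
by rewrite ipZr// ip_chi f0// addr0 -ip_chibar// mulrC subrr.
Qed.

(** [epsilon] satisfies [is_proj] because [shiftK f] is a witness. Two projections of the same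
    function differ by an element of the model space orthogonal to itself, hence agree a.e. and no
    better. *)
Lemma Sop_shiftK f : Kspace th f -> Kspace th (Sop th f) /\ aeqT (Sop th f) (shiftK f).
Proof.
move=> fK; have fL := K_L2 fK; have sK := K_shiftK fK.
have thL := H2_L2 inner_H2.
have sP : is_proj (Kspace th) (fun t => chi t * f t) (shiftK f).
  split=> // k kK.
  have -> : (fun t => chi t * f t - shiftK f t) = (fun t => ip f (chibar th) * th t).
    by apply/funext => t; rewrite opprB addrC subrK.
  rewrite ipZl//; last exact: K_L2.
  rewrite (ip_sym_eq0 _ _ (ip_K_inner kK)) ?mulr0//; exact: K_L2.
have [pK pP] : is_proj (Kspace th) (fun t => chi t * f t) (Sop th f).
  exact: (ClassicalEpsilon.epsilon_spec (inhabits (fun _ : R => 0 : C))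
    (is_proj (Kspace th) (fun t => chi t * f t)) (ex_intro _ _ sP)).
split=> //; have dK := KB pK sK; have dL := K_L2 dK.
have xL := L2_chi fL; have pL := K_L2 pK; have sL := K_L2 sK.
have d0 : ip (fun t => Sop th f t - shiftK f t) (fun t => Sop th f t - shiftK f t) = 0.
  have e := pP _ dK; have e' := sP.2 _ dK.
  rewrite ipBl// in e; rewrite ipBl// in e'; rewrite ipBl//.
  by apply/eqP; rewrite subr_eq0 -(subr0_eq e) -(subr0_eq e').
have /aeqTP H := ip_self_eq0 dL d0.
apply/aeqTP; apply: ae_imp H => t K Tt; apply/eqP.
by rewrite -subr_eq0 K.
Qed.

(** The geometric sum of powers of [th] in Horner form, [1 + th * s]. The cross term integrates to 0
    because [th] vanishes at the origin, and [th] has modulus one a.e., so each step adds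
    [2 * pi]. *)
Lemma sum_geometric_H2 N : exists2 s : R -> C,
  H2 s /\ (forall t, th t = 1 -> s t = N%:R) &
  rint (fun t => sqnorm (s t)) = N%:R * (2 * pi).
Proof.
elim: N => [|N [s [sH sN] si]].
  exists (fun=> 0); first by split=> //; exact: H2_cst.
  by rewrite sqnorm0 rint_cst !mul0r.
have tsH := H2_innerM sH; have tsL := H2_L2 tsH.
exists (fun t => 1 + th t * s t).
  split; first by apply: H2D => //; exact: H2_cst.
  by move=> t t1; rewrite t1 mul1r sN// -natr1 addrC.
have [ci _] := L2_cintegrable tsL.
have -> : (fun t => sqnorm (1 + th t * s t)) =
    (fun t => (1 + sqnorm (th t * s t)) + 2 * cre (th t * s t)).
  by apply/funext => t; move: (th t * s t) => z; rewrite /sqnorm creD cimD /=; ring.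
have oi := @rintegrable_cst R 1; have qi := L2_sqnorm tsL.
rewrite rintD; [|exact: rintegrableD|exact: rintegrableZ].
rewrite rintD// rintZ// rint_cst.
rewrite (congr1 (@cre R) (at0_H2_mul inner_H2 sH th0) : rint _ = 0) mulr0 addr0.
have -> : rint (fun t => sqnorm (th t * s t)) = rint (fun t => sqnorm (s t)).
  apply: rint_ae.
  - exact: meas_sqnorm (L2_cmeas tsL).
  - exact: meas_sqnorm (L2_cmeas (H2_L2 sH)).
  - by apply: ae_imp inner_ae => t H Tt; rewrite sqnormM H// mul1r.
by rewrite si -natr1; ring.
Qed.

(* [|1 + theta + ... + theta^(N-1)|^2] has mean [N] and equals [N^2]
   where [theta = 1]. *)
Lemma inner_neq1_ae : \forall t \ae mu, T t -> th t != 1.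
Proof.
have [m1 m2] := inner_cmeas.
pose E : set (measurableTypeR R) :=
  (T `&` (fun t => cre (th t)) @^-1` [set 1]) `&`
  (T `&` (fun t => cim (th t)) @^-1` [set 0]).
have mE : measurable E.
  by apply: measurableI; [apply: m1|apply: m2] => //; exact: measurable_set1.
have EP t : T t -> (t \in E) = (th t == 1).
  move=> Tt; rewrite eq_complex; apply/idP/andP.
    by rewrite inE => -[[_ /= a] [_ /= b]]; split; apply/eqP.
  by move=> [/eqP a /eqP b]; rewrite inE; split.
pose I t : R := \1_E t.
have Ii : rintegrable I.
  have mI : measurable_fun TT I by apply: measurable_indic.
  apply: (rintegrable_ae_le mI (rintegrable_cst 1)); apply: aeW => t _.
  by rewrite /I indicE; case: (_ \in _); rewrite /= ?normr1 ?normr0.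
have I0 t : 0 <= I t by rewrite /I indicE.
have bound N : N%:R * rint I <= 2 * pi.
  case: N => [|N]; first by rewrite mul0r ltW// pi2_gt0.
  have [s [sH sN] si] := sum_geometric_H2 N.+1.
  have N0 : 0 < N.+1%:R :> R by rewrite ltr0n.
  (* A further factor [N.+1] turns the claim into the comparison of [N.+1 ^ 2] times the indicator
     with [sqnorm (s t)]. *)
  rewrite -(ler_pM2l N0) -si mulrA -rintZ//.
  apply: rint_le; [exact: rintegrableZ|exact/L2_sqnorm/H2_L2|].
  move=> t Tt; rewrite /I indicE EP//; have [t1|_] := eqVneq (th t) 1.
    rewrite sN// mulr1 -expr2 /sqnorm.
    have -> : N.+1%:R = (N.+1%:R : R)%:C by rewrite rmorph_nat.
    by rewrite /= expr0n addr0.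
  by rewrite mulr0 sqnorm_ge0.
have rI : rint I = 0.
  apply/eqP; rewrite eq_le rint_ge0// andbT leNgt; apply/negP => rI0.
  have := bound (Num.truncn (2 * pi / rint I)).+1.
  rewrite -ler_pdivlMr// leNgt.
  have := real_truncnS_gt (num_real (2 * pi / rint I)).
  by move=> ->.
apply: ae_imp (rint_eq0_ae Ii I0 rI) => t H Tt.
move: (H Tt); rewrite /I indicE EP//; case: (th t == 1) => //= /eqP.
by rewrite oner_eq0.
Qed.

End Inner.

End Hardy.

(** * The unitary operator and the intertwining relation *)

Section Clark.
Set Implicit Arguments.
Unset Strict Implicit.
Local Open Scope classical_set_scope.
Variable R : realType.
Local Notation C := R[i].
Local Notation mu := (@lebesgue_measure R).
Local Notation T := (@Tdom R).
Variable th : R -> C.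
Hypotheses (thI : inner th) (th0 : at0 th = 0).

Lemma K_Uop f : Kspace th f -> Kspace th (Uop th 1 f) /\
  aeqT (Uop th 1 f) (fun t => chi t * f t + ip f (chibar th) * (1 - th t)).
Proof.
move=> fK; have [sK /aeqTP sE] := Sop_shiftK thI fK; split.
  apply: (KD thI) => //; apply: (KZ thI); apply: (KZ thI).
  exact: (K_one thI th0).
apply/aeqTP; apply: ae_imp sE => t H Tt.
by rewrite /Uop H// /rank1 /shiftK /Defs.one; ring.
Qed.

(* [U^-1 f = conj chi * (f - f(0)) + f(0) * conj chi * theta] *)
Lemma Uop_surj f : Kspace th f -> exists2 f', Kspace th f' &
  forall t, f t = chi t * f' t + ip f' (chibar th) * (1 - th t).
Proof.
move=> fK; have [fH fort] := fK; set a := at0 f.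
pose k t := f t - a * Defs.one t + a * th t.
have thH := inner_H2 thI; have thL := H2_L2 thH; have fL := H2_L2 fH.
have oH : H2 (@Defs.one R) := H2_cst 1; have oL := H2_L2 oH.
have aoH := H2Z a oH; have athH := H2Z a thH.
have aoL := H2_L2 aoH; have athL := H2_L2 athH.
have kE g : L2 g -> ip k g = ip f g - a * ip (@Defs.one R) g + a * ip th g.
  move=> gL; rewrite ipDl//; last exact: L2B.
  by rewrite ipBl// !ipZl.
have kH : H2 k by apply: H2D => //; exact: H2B.
have k0 : at0 k = 0.
  by rewrite at0E kE// ip_one_one -(at0E f) -(at0E th) th0 mulr1 mulr0 subrr addr0.
have kK : Kspace th (chibar k).
  apply: K_chibar => // h hH; have xH := H2_chi hH.
  have xL := H2_L2 (H2_innerM thI xH).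
  (* Of the three terms of [k], [f] and [one] lie in the model space; the last reduces to the
     pairing of [one] with [chi * h], which is 0. *)
  rewrite kE// fort// (K_one thI th0).2// mulr0 subr0 add0r.
  have -> : ip th (fun t => th t * (chi t * h t)) =
      ip (@Defs.one R) (fun t => chi t * h t).
    rewrite -(ip_innerM thI oL (H2_L2 xH)).
    suff -> : (fun t => th t * Defs.one t) = th by [].
    by apply/funext => t; rewrite mulr1.
  rewrite ip_sym_eq0 ?mulr0//; first exact: H2_L2.
  rewrite -at0E; apply/at0_eq0; have [_ /(_ 1 isT) h1] := (H2P h).1 hH.
  by rewrite -[RHS]h1; congr cint; apply/funext => t; rewrite mulrC chiE.
exists (chibar k) => //.
(* This is the pairing of [k] with [th]: [f] and [one] are orthogonal to [th], which has norm one,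
   so only [a] survives. *)
have -> : ip (chibar k) (chibar th) = a.
  rewrite ip_chibar//; last exact/L2_chibar/H2_L2.
  rewrite (funext (chi_chibar k)) kE// (ip_K_inner fK).
  rewrite [ip (@Defs.one R) th]ip_sym// -at0E th0 cconj0 mulr0 subrr add0r.
  suff -> : ip th th = 1 by rewrite mulr1.
  rewrite -(@ip_one_one R) -(ip_innerM thI oL oL).
  suff -> : (fun t => th t * Defs.one t) = th by [].
  by apply/funext => t; rewrite mulr1.
by move=> t; rewrite chi_chibar /k /Defs.one; ring.
Qed.

Section Intertwining.
Variables (om u : R -> C) (X : (R -> C) -> (R -> C)).
Hypotheses (omI : inner om) (uK : Kspace om u).
Hypothesis Xb : bounded_op (Kspace th) (Kspace om) X.
Hypothesis Xadj : adj_maps (Kspace th) X (chibar om) (chibar th).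
Hypothesis XU : forall f, Kspace th f -> aeqT (X (Uop th 1 f)) (Top om u (X f)).

(** The claimed identity with its denominator cleared: it stays integrable and analytic, whereas
    [1 / (1 - th)] need not be bounded. *)
Definition defect f t : C := (1 - th t) * X f t - (u t - om t) * f t.

Lemma XK f : Kspace th f -> Kspace om (X f). Proof. by case: Xb => H _ _ _; exact: H. Qed.

Lemma cintegrable_defect f : Kspace th f -> cintegrable (defect f).
Proof.
move=> fK; have xL := K_L2 (XK fK); have fL := K_L2 fK.
have thL := H2_L2 (inner_H2 thI); have omL := H2_L2 (inner_H2 omI).
have uL := K_L2 uK.
apply: cintegrableB; apply: L2_cintegrableM => //; apply: L2B => //.
exact: L2_cst.
Qed.

Lemma defect_chi f : Kspace th f -> exists2 f', Kspace th f' &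
  aeqT (defect f) (fun t => chi t * defect f' t).
Proof.
move=> fK; have [f' fK' fE] := Uop_surj fK; exists f' => //.
have [UK /aeqTP UE] := K_Uop fK'; have [_ Xae _ _] := Xb.
have fU : aeqT f (Uop th 1 f').
  by apply/aeqTP; apply: ae_imp UE => t H Tt; rewrite H// fE.
have [_ /aeqTP sE] := Sop_shiftK omI (XK fK').
have /aeqTP XfU := Xae _ _ fK UK fU; have /aeqTP XUT := XU fK'.
apply/aeqTP; apply: ae_imp3 XfU XUT sE => t H1 H2 H3 Tt.
(* [Xadj] equates the two rank-one coefficients; with common value [c], the terms
   [c * (1 - th) * (u - om)] cancel. *)
rewrite /defect H1// H2// /Top H3// /shiftK /rank1 Xadj// fE.
by ring.
Qed.

Lemma cint_defect_pos f (m : int) : Kspace th f -> 0 < m ->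
  cint (fun t => defect f t * expi (m%:~R * t)) = 0.
Proof.
move=> fK m0; have xK := XK fK; have oH := @H2_cst R 1.
have thH := inner_H2 thI; have omH := inner_H2 omI.
have H1 : H2 (fun t => 1 - th t) by exact: H2B.
have H3 : H2 (fun t => u t - om t) by apply: H2B => //; case: uK.
have [xH _] := xK; have [fH _] := fK.
have eL := @L2_expi R m%:~R.
have -> : (fun t => defect f t * expi (m%:~R * t)) =
  (fun t => (1 - th t) * X f t * expi (m%:~R * t)
            - (u t - om t) * f t * expi (m%:~R * t)).
  by apply/funext => t; rewrite /defect mulrBl.
rewrite cintB ?cint_H2_mul ?subr0//; apply: cintegrableM_expi;
  by apply: L2_cintegrableM; exact: H2_L2.
Qed.

(* Since [defect f = chi * defect (U^-1 f)], the vanishing of the negative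
   coefficients propagates to all of them. *)
Lemma cint_defect f (m : int) : Kspace th f ->
  cint (fun t => defect f t * expi (m%:~R * t)) = 0.
Proof.
(* Each induction step trades [f] for a preimage and [m] for [m + 1], so [f] and [m] stay general.
   The strict bound makes [n = 0] the analytic case and calls for [n = |m| + 1] at the end. *)
suff H (n : nat) : forall f m, Kspace th f -> - n%:Z < m ->
    cint (fun t => defect f t * expi (m%:~R * t)) = 0.
  by move=> fK; apply: (H `|m|%N.+1) => //; lia.
elim: n => [|n IH] {}f {}m fK mn; first by apply: cint_defect_pos => //; lia.
have [f' fK' /aeqTP fE] := defect_chi fK.
rewrite -[RHS](IH f' (m + 1) fK'); last by lia.
have em := @cmeas_expi R m%:~R; have em1 := @cmeas_expi R (m + 1)%:~R.
have dm := cintegrable_meas (cintegrable_defect fK).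
have dm' := cintegrable_meas (cintegrable_defect fK').
apply: cint_ae; [exact: cmeasM|exact: cmeasM|].
apply/aeqTP; apply: ae_imp fE => t H Tt.
have -> : (m + 1)%:~R * t = m%:~R * t + 1 * t by rewrite intrD mulrDl.
by rewrite H// expiD chiE; ring.
Qed.

Lemma defect_eq0 f : Kspace th f -> aeqT (defect f) (fun=> 0).
Proof.
move=> fK; apply: cint_expi_eq0_ae; first exact: cintegrable_defect.
by move=> n; exact: cint_defect.
Qed.

Lemma X_mul f : Kspace th f ->
  aeqT (X f) (fun t => (u t - om t) / (1 - th t) * f t).
Proof.
move=> fK; have /aeqTP d0 := defect_eq0 fK.
apply/aeqTP; apply: ae_imp2 d0 (inner_neq1_ae thI th0) => t H1 H2 Tt.
have t1 : 1 - th t != 0 by rewrite subr_eq0 eq_sym H2.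
move: (H1 Tt) => /eqP; rewrite /defect subr_eq0 => /eqP e.
by rewrite mulrAC -e mulrAC divff ?mul1r.
Qed.

(** The quotient equals [X one] only a.e., so membership is transferred by [K_ae], which asks for
    measurability of the quotient; the inverse of 0 counts as 0 there. *)
Lemma K_symbol : Kspace om (fun t => (u t - om t) / (1 - th t)).
Proof.
have oK := K_one thI th0; have xK := XK oK.
apply: (K_ae omI _ _ xK).
- apply: cmeasM; first by apply: cmeasB; [exact: L2_cmeas (K_L2 uK)|exact: inner_cmeas].
  by apply: cmeasV; apply: cmeasB; [exact: cmeas_cst|exact: inner_cmeas].
- have /aeqTP H := X_mul oK.
  by apply/aeqTP; apply: ae_imp H => t K Tt; rewrite K// mulr1.
Qed.

End Intertwining.
End Clark.

Theorem theorem3p5 (R : realType) (theta omega u : R -> R[i])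
  (X : (R -> R[i]) -> (R -> R[i])) :
  inner theta -> inner omega -> at0 theta = 0 -> at0 omega = 0 ->
  Kspace omega u ->
  bounded_op (Kspace theta) (Kspace omega) X ->
  adj_maps (Kspace theta) X (chibar omega) (chibar theta) ->
  (forall f, Kspace theta f ->
     aeqT (X (Uop theta 1 f))
           (Top omega u (X f))) ->
  let g := fun t => (u t - omega t) / (1 - theta t) in
  Kspace omega g /\
  (forall f, Kspace theta f -> aeqT (X f) (fun t => g t * f t)).
Proof.
move=> thI omI th0 om0 uK Xb Xadj XU g; split.
  exact: (K_symbol thI th0 omI uK Xb Xadj XU).
by move=> f fK; exact: (X_mul thI th0 omI uK Xb Xadj XU).
Qed.
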